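(* Let $e\ge 1$ and $r\ge 3$ be integers and let $B=B(e,e,r)$. Write $\mathbb{Z}_n=\mathbb{Z}/n\mathbb{Z}$. Then: \begin{itemize} \item if $r=3$, then $H_2(B,\mathbb{Z})\simeq \mathbb{Z}_e$; \item if $r=4$ and $e$ is odd, then $H_2(B,\mathbb{Z})\simeq \mathbb{Z}_e\times\mathbb{Z}_2\simeq\mathbb{Z}_{2e}$; \item if $r=4$ and $e$ is even, then $H_2(B,\mathbb{Z})\simeq \mathbb{Z}_e\times\mathbb{Z}_2^2$; \item if $r\ge 5$, then $H_2(B,\mathbb{Z})\simeq\mathbb{Z}_e\times\mathbb{Z}_2$. \end{itemize}
   Context: $G(e,e,r)\subset GL_r(\mathbb{C})$ is the group of monomial $r\times r$ matrices whose nonzero entries are $e$-th roots of unity with product $1$. Let $\mathcal{M}(e,r)=\{(z_1,\dots,z_r)\in\mathbb{C}^r : z_i\neq\eta z_j \text{ for all } i\ne j \text{ and all } \eta \text{ with } \eta^e=1\}$. The complex braid group is $B(e,e,r)=\pi_1(\mathcal{M}(e,r)/G(e,e,r))$. Homology is group homology with trivial coefficients. Equivalently (known result of Corran and Picantin) $B(e,e,r)$ has a presentation with generators $t_0,\dots,t_{e-1},s_3,\dots,s_r$ and relations: $t_{i+1}t_i=t_{j+1}t_j$ (indices modulo $e$); $s_3t_is_3=t_is_3t_i$; $s_kt_i=t_is_k$ for $k\ge4$; $s_ks_{k+1}s_k=s_{k+1}s_ks_{k+1}$ for $k\ge 3$; $s_ks_l=s_ls_k$ for $|k-l|\ge2$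 (for $e=1$ the first relation is empty, and the group is the usual braid group on $r$ strands). *)

(* Defs.v *)
(* Classical decidability (boolp) turns the quotients below -- a group given by
   a presentation, cycles modulo boundaries -- into MathComp structures. *)
From HB Require Import structures.
From mathcomp Require Import all_boot all_algebra generic_quotient ring_quotient.
From mathcomp Require Import boolp.
From mathcomp Require Import freeg.

Set Implicit Arguments.
Unset Strict Implicit.
Unset Printing Implicit Defensive.

Import GRing.Theory.

Local Open Scope ring_scope.
Local Open Scope quotient_scope.

Section GroupPresentation.
Variables (X : choiceType).

(* The letter (x, false) stands for the generator x, (x, true) for its
   inverse. *)
Definition word := seq (X * bool).

Definition posword (s : seq X) : word := [seq (x, false) | x <- s].

Definition invword (u : word) : word := rev [seq (x.1, ~~ x.2) | x <- u].

Variable R : seq X -> seq X -> Prop.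

Inductive word_eqv : word -> word -> Prop :=
| WordRefl u : word_eqv u u
| WordSym u v : word_eqv u v -> word_eqv v u
| WordTrans u v w : word_eqv u v -> word_eqv v w -> word_eqv u w
| WordCat u u' v v' : word_eqv u u' -> word_eqv v v' ->
    word_eqv (u ++ v) (u' ++ v')
| WordCancel x b : word_eqv [:: (x, b); (x, ~~ b)] [::]
| WordRel s t : R s t -> word_eqv (posword s) (posword t).

Definition word_eqb : rel word := fun u v => `[< word_eqv u v >].

Lemma word_eqb_equiv : equiv_class_of word_eqb.
Proof.
split=> [u|u v|v u w].
- by apply/asboolP; exact: WordRefl.
- by apply/asboolP/asboolP; exact: WordSym.
- by move=> /asboolP uv /asboolP vw; apply/asboolP; exact: WordTrans uv vw.
Qed.

Canonical word_equivRel := EquivRelPack word_eqb_equiv.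
Canonical word_encModRel := defaultEncModRel word_eqb.

(* The group < X | s = t for all s, t such that R s t >; as in a monoid
   presentation, both sides of a relation are positive words. *)
Definition presented_group : Type := {eq_quot word_eqb}.

HB.instance Definition _ : EqQuotient word word_eqb presented_group :=
  EqQuotient.on presented_group.
HB.instance Definition _ := Choice.on presented_group.

Lemma presented_eqP (u v : word) :
  reflect (word_eqv u v) (u == v %[mod presented_group]).
Proof. by rewrite piE; exact: asboolP. Qed.

Lemma eq_presented (u v : word) :
  word_eqv u v -> u = v %[mod presented_group].
Proof. by move=> uv; apply/eqP/presented_eqP. Qed.

Lemma repr_presented (u : word) :
  word_eqv (repr (\pi_presented_group u)) u.
Proof. by apply/presented_eqP; rewrite reprK. Qed.

Lemma invwordK : involutive invword.
Proof.
move=> u; rewrite /invword map_rev revK -map_comp -[RHS]map_id.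
by apply: eq_map => -[x b] /=; rewrite negbK.
Qed.

Lemma invword_cat u v : invword (u ++ v) = invword v ++ invword u.
Proof. by rewrite /invword map_cat rev_cat. Qed.

Lemma word_eqv_mulV u : word_eqv (u ++ invword u) [::].
Proof.
elim: u => [|[x b] u IHu]; first exact: WordRefl.
rewrite /invword /= rev_cons -/(invword u) -cats1 catA -cat_cons.
apply: WordTrans (WordCancel x b).
rewrite -[[:: _; _]]/([:: (x, b)] ++ [:: (x, ~~ b)]).
apply: WordCat; last exact: WordRefl.
rewrite -cat1s -[X in word_eqv _ X]cats0.
by apply: WordCat => //; exact: WordRefl.
Qed.

Lemma word_eqv_inv u v : word_eqv u v -> word_eqv (invword u) (invword v).
Proof.
move=> uv; have h w : word_eqv (invword w ++ w) [::].
  by rewrite -{2}[w]invwordK; exact: word_eqv_mulV.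
have h1 : word_eqv (invword u) (invword u ++ (v ++ invword v)).
  rewrite -[X in word_eqv X _]cats0; apply: WordCat; first exact: WordRefl.
  by apply: WordSym; exact: word_eqv_mulV.
apply: (WordTrans h1); rewrite catA -[X in word_eqv _ X]cat0s.
apply: WordCat; last exact: WordRefl.
apply: WordTrans (h u); apply: WordCat; first exact: WordRefl.
exact: WordSym.
Qed.

Definition presented_one : presented_group :=
  \pi_presented_group ([::] : word).
Definition presented_mul (a b : presented_group) : presented_group :=
  \pi_presented_group (repr a ++ repr b).
Definition presented_inv (a : presented_group) : presented_group :=
  \pi_presented_group (invword (repr a)).

Lemma presented_mulE u v :
  presented_mul (\pi u) (\pi v) = \pi_presented_group (u ++ v).
Proof. by apply: eq_presented; apply: WordCat; exact: repr_presented. Qed.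

Lemma presented_invE u :
  presented_inv (\pi u) = \pi_presented_group (invword u).
Proof. by apply: eq_presented; apply: word_eqv_inv; exact: repr_presented. Qed.

Fact presented_mulA : associative presented_mul.
Proof.
by elim/quotW=> a; elim/quotW=> b; elim/quotW=> c; rewrite !presented_mulE catA.
Qed.

Fact presented_mul1 : left_id presented_one presented_mul.
Proof. by elim/quotW=> a; rewrite presented_mulE. Qed.

Fact presented_mulr1 : right_id presented_one presented_mul.
Proof. by elim/quotW=> a; rewrite presented_mulE cats0. Qed.

Fact presented_mulV : left_inverse presented_one presented_inv presented_mul.
Proof.
elim/quotW=> a; rewrite presented_invE presented_mulE; apply: eq_presented.
by rewrite -{2}[a]invwordK; exact: word_eqv_mulV.
Qed.

Fact presented_mulrV : right_inverse presented_one presented_inv presented_mul.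
Proof.
elim/quotW=> a; rewrite presented_invE presented_mulE.
by apply: eq_presented; exact: word_eqv_mulV.
Qed.

HB.instance Definition _ := isGroup.Build presented_group presented_mulA
  presented_mul1 presented_mulr1 presented_mulV presented_mulrV.

End GroupPresentation.

(* Generators of B(e,e,r): the t_i with i in Z/e, and the s_k with
   3 <= k <= r, indexed by their actual k. *)
Definition s_index (r : nat) := {k : 'I_r.+1 | (3 <= k)%N}.

Definition braid_gen (e r : nat) := ('I_e + s_index r)%type.

Section CorranPicantin.
Variables e r : nat.

Local Notation t i := (inl i : braid_gen e r).
Local Notation s k := (inr k : braid_gen e r).
Local Notation num k := (nat_of_ord (val k)).

(* The Corran-Picantin presentation of B(e,e,r); ordS is the successor
   modulo e. *)
Inductive braid_rel : seq (braid_gen e r) -> seq (braid_gen e r) -> Prop :=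
| BraidTT (i j : 'I_e) :
    braid_rel [:: t (ordS i); t i] [:: t (ordS j); t j]
| BraidS3T (k : s_index r) (i : 'I_e) : num k = 3%N ->
    braid_rel [:: s k; t i; s k] [:: t i; s k; t i]
| BraidST (k : s_index r) (i : 'I_e) : (4 <= num k)%N ->
    braid_rel [:: s k; t i] [:: t i; s k]
| BraidSSS (k l : s_index r) : num l = (num k).+1 ->
    braid_rel [:: s k; s l; s k] [:: s l; s k; s l]
| BraidSS (k l : s_index r) : (num k + 2 <= num l)%N ->
    braid_rel [:: s k; s l] [:: s l; s k].

End CorranPicantin.

(* B(e,e,r) = pi_1(M(e,r) / G(e,e,r)), through the presentation proved by
   Corran and Picantin (for e >= 1 and r >= 3). *)
Definition braid_group (e r : nat) : groupType :=
  presented_group (@braid_rel e r).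

(* Homology with trivial coefficients Z, computed by the (inhomogeneous) bar
   complex: degree n is free abelian on n-tuples, and
   d [g_1|...|g_(n+1)] is
     [g_2|...|g_(n+1)]
     + sum_(1 <= i <= n) (-1)^i [g_1|...|g_i g_(i+1)|...|g_(n+1)]
     + (-1)^(n+1) [g_1|...|g_n]. *)
Section BarComplex.
Variable G : groupType.

Definition bar_chain (n : nat) : zmodType := {freeg (n.-tuple G)}.

(* Positions are numbered from 0: the j-th entry of the i-th face is g_j if
   j + 1 < i, the product g_j g_(j+1) if j + 1 = i, and g_(j+1) if i <= j. *)
Definition bar_face n (i : 'I_n.+2) (g : n.+1.-tuple G) : n.-tuple G :=
  [tuple (if (j.+1 < i)%N then nth 1%g g j
          else if j.+1 == i :> nat then (nth 1 g j * nth 1 g j.+1)%g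
          else nth 1%g g j.+1) | j < n].

Definition bar_d_gen n (g : n.+1.-tuple G) : {freeg (n.-tuple G)} :=
  \sum_(i < n.+2) << (-1) ^+ i *g bar_face i g >>.

Definition bar_d n : bar_chain n.+1 -> bar_chain n :=
  fglift (@bar_d_gen n).

Lemma bar_d_is_zmod_morphism n : zmod_morphism (@bar_d n).
Proof. exact: lift_is_additive. Qed.

HB.instance Definition _ n :=
  GRing.isZmodMorphism.Build _ _ (@bar_d n) (@bar_d_is_zmod_morphism n).

Definition is_cycle n : bar_chain n -> bool :=
  match n with
  | 0 => fun=> true
  | n'.+1 => fun x => bar_d x == 0
  end.

Lemma is_cycle_zmod_closed n : zmod_closed (@is_cycle n).
Proof.
case: n => [|n]; split=> //=; first by rewrite unfold_in /= raddf0.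
move=> x y; rewrite !unfold_in /= => /eqP dx /eqP dy.
by apply/eqP; rewrite raddfB /= dx dy subrr.
Qed.

HB.instance Definition _ n :=
  GRing.isZmodClosed.Build _ (@is_cycle n) (@is_cycle_zmod_closed n).

Record cycles n :=
  Cycle { cycle_val :> bar_chain n; cycle_valP : is_cycle cycle_val }.

HB.instance Definition _ n := [isSub for @cycle_val n].
HB.instance Definition _ n := [Choice of cycles n by <:].
HB.instance Definition _ n := [SubChoice_isSubZmodule of cycles n by <:].

(* As bar_d (bar_d y) = 0, every bar_d y is (the value of) a cycle. *)
Definition is_boundary n (x : cycles n) : bool :=
  `[< exists y : bar_chain n.+1, bar_d y = val x >].

Lemma is_boundary_zmod_closed n : zmod_closed (@is_boundary n).
Proof.
split=> [|x y]; rewrite !unfold_in.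
  by apply/asboolP; exists 0; rewrite !raddf0.
move=> /asboolP[u du] /asboolP[v dv]; apply/asboolP; exists (u - v).
by rewrite !raddfB /= du dv.
Qed.

HB.instance Definition _ n :=
  GRing.isZmodClosed.Build _ (@is_boundary n) (@is_boundary_zmod_closed n).

Definition group_homology (n : nat) : zmodType :=
  Quotient.quot (GRing.ZmodClosed.clone _ (@is_boundary n) _).

End BarComplex.

(* Z/nZ for n >= 1; unlike 'Z_n, this is trivial for n = 1. *)
Definition Zmod (n : nat) : zmodType := 'I_n.-1.+1.

Definition zmod_isom (U V : zmodType) : Prop :=
  exists f : {additive U -> V}, bijective f.

(* Main.v *)
(* Let U be the group of bar 2-chains modulo boundaries. The symbols [g|h] form
   a universal 2-cocycle, hence a central extension E of the group G by U, and
   H_2(G) is the kernel of the differential U -> Z[G]. If the generators of a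
   presentation are lifted to E so that the relations hold modulo a subgroup of
   U, this subgroup contains H_2(G).
   For B(e,e,r), lifting the generators as suitable conjugates of one another
   makes all braid relations exact. Then t_(i+1) t_i and t_i t_(i-1) differ by a
   class b which is independent of i, because s_3 t_1 t_0 s_3 conjugates t_i to
   t_(i+1); hence e b = 0. The commutators of commuting generators have order 2,
   as a half twist of s_3 and its neighbours exchanges the two generators; those
   of s_4 with t_i and t_(i+2) agree, and all of them agree when r >= 5.
   Conversely, the order of b is detected by a Heisenberg-like extension of the
   action on strands which records the winding of a strand around the cone point
   of order e, and the commutators by the double cover of the symmetric group
   inside a Clifford algebra; for r = 4 and e even this cover is also pulled
   back along the folding B(e,e,4) -> B(2,2,4) -> B(1,1,4) which sends s_4 to
   t_0, and t_i to t_0 or s_4 according to the parity of i. *)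
Require Import Defs.
From HB Require Import structures.
From mathcomp Require Import all_boot all_algebra.
From mathcomp Require Import generic_quotient ring_quotient.
From mathcomp Require Import boolp.
From mathcomp Require Import freeg zify ring.

Set Implicit Arguments.
Unset Strict Implicit.
Unset Printing Implicit Defensive.

Import GRing.Theory.

Local Open Scope ring_scope.
Local Open Scope quotient_scope.

(** * Additive maps out of free abelian groups *)

Section FreegExt.
Variables (K : choiceType) (A : zmodType).

Lemma freeg_additive_eq (f g : {additive {freeg K} -> A}) :
  (forall z, f << z >> = g << z >>) -> f =1 g.
Proof.
move=> fg D; rewrite -(freeg_sumE D) !raddf_sum; apply: eq_bigr => z _.
by rewrite -[coeff z D]intz -freegU_mulz !raddfMz fg.
Qed.

Definition freeg_ext (f : K -> A) : {freeg K} -> A :=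
  fglift (f : K -> zmodule A).

Lemma freeg_ext_is_zmod_morphism f : zmod_morphism (freeg_ext f).
Proof. exact: (lift_is_additive (f : K -> zmodule A)). Qed.

HB.instance Definition _ f :=
  GRing.isZmodMorphism.Build _ _ (freeg_ext f) (freeg_ext_is_zmod_morphism f).

Lemma freeg_extU f z : freeg_ext f << z >> = f z.
Proof. by rewrite /freeg_ext liftU (scale1r (f z : zmodule A)). Qed.

End FreegExt.

Lemma tuple2E (T : Type) (z : 2.-tuple T) : z = [tuple tnth z 0; tnth z 1].
Proof.
apply: eq_from_tnth => -[[|[|]] //= ?];
  by rewrite [RHS](tnth_nth (tnth z 0)) /=; congr tnth; apply: val_inj.
Qed.

Lemma tuple3E (T : Type) (z : 3.-tuple T) :
  z = [tuple tnth z 0; tnth z 1; tnth z 2%:R].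
Proof.
apply: eq_from_tnth => -[[|[|[|]]] //= ?];
  by rewrite [RHS](tnth_nth (tnth z 0)) /=; congr tnth; apply: val_inj.
Qed.

(** * The universal central extension of the bar complex *)

Section LowDegree.
Variable G : groupType.

Lemma bar_d1E (g h : G) :
  bar_d << [tuple g; h] >> =
  << [tuple h] >> - << [tuple (g * h)%g] >> + << [tuple g] >> :> bar_chain G 1.
Proof.
rewrite /bar_d liftU scale1r /bar_d_gen !big_ord_recl big_ord0 addr0 /=.
rewrite expr0 expr1 /bump /= addrA expr2 mulrNN mulr1 freegUN.
by congr (<< _ *g _ >> + << _ *g _ >> + << _ *g _ >>);
  apply: eq_from_tnth => i; rewrite tnth_mktuple ord1 !(tnth_nth 1%g).
Qed.

Lemma bar_d2E (g h k : G) :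
  bar_d << [tuple g; h; k] >> =
  << [tuple h; k] >> - << [tuple (g * h)%g; k] >>
    + << [tuple g; (h * k)%g] >> - << [tuple g; h] >> :> bar_chain G 2.
Proof.
rewrite /bar_d liftU scale1r /bar_d_gen !big_ord_recl big_ord0 addr0 /=.
rewrite /bump /= !exprS expr0 !mulr1 !mulrNN !mulr1 !addrA !freegUN.
by congr (<< _ *g _ >> + << _ *g _ >> + << _ *g _ >> + << _ *g _ >>);
  apply: eq_from_tnth => i; rewrite tnth_mktuple !(tnth_nth 1%g);
  case: i => [[|[]]].
Qed.

(** Unlike [is_boundary], this concerns all 2-chains, so that the quotient contains the symbols
    [g|h] themselves and not only cycles. *)
Definition is_bar_boundary (x : bar_chain G 2) : bool :=
  `[< exists y : bar_chain G 3, bar_d y = x >].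

Lemma is_bar_boundary_zmod_closed : zmod_closed is_bar_boundary.
Proof.
split=> [|x y]; rewrite !unfold_in.
  by apply/asboolP; exists 0; rewrite raddf0.
move=> /asboolP[u <-] /asboolP[v <-]; apply/asboolP; exists (u - v).
by rewrite raddfB.
Qed.

HB.instance Definition _ :=
  GRing.isZmodClosed.Build _ is_bar_boundary is_bar_boundary_zmod_closed.

Definition bar_coker : zmodType :=
  Quotient.quot (GRing.ZmodClosed.clone _ is_bar_boundary _).

Definition coker_pi (x : bar_chain G 2) : bar_coker := \pi x.

Lemma coker_pi_is_zmod_morphism : zmod_morphism coker_pi.
Proof. by move=> x y; rewrite /coker_pi raddfB. Qed.

HB.instance Definition _ :=
  GRing.isZmodMorphism.Build _ _ coker_pi coker_pi_is_zmod_morphism.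

Lemma coker_pi_surj u : exists x, u = coker_pi x.
Proof. by exists (repr u); rewrite /coker_pi reprK. Qed.

Lemma coker_pi_eq0 x : coker_pi x = 0 <-> exists y : bar_chain G 3, bar_d y = x.
Proof.
rewrite -(raddf0 coker_pi); split.
  by move=> /eqP; rewrite /coker_pi -Quotient.idealrBE subr0 => /asboolP.
move=> yx; apply/eqP; rewrite /coker_pi -Quotient.idealrBE subr0.
exact/asboolP.
Qed.

(* Not normalised, so that the unit of the extension below is not (0, 1). *)
Definition cocycle (g h : G) : bar_coker := coker_pi << [tuple g; h] >>.

(** This is the boundary of [g|h|k], which is zero in [bar_coker]. *)
Lemma cocycleP g h k :
  cocycle g h + cocycle (g * h)%g k = cocycle g (h * k)%g + cocycle h k.
Proof.
have := coker_pi_eq0 (bar_d << [tuple g; h; k] >>).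
case=> _ /(_ (ex_intro _ _ erefl)); rewrite bar_d2E !(raddfB, raddfD) /=.
rewrite -/(cocycle _ _) => /eqP; rewrite subr_eq0 => /eqP e.
by rewrite /cocycle -e addrAC subrK addrC.
Qed.

Lemma cocycle1g g : cocycle 1%g g = cocycle 1%g 1%g.
Proof. by have := cocycleP 1%g 1%g g; rewrite !mul1g => /addIr. Qed.

Lemma cocycleg1 g : cocycle g 1%g = cocycle 1%g 1%g.
Proof. by have := cocycleP g 1%g 1%g; rewrite !mulg1 => /addrI. Qed.

Lemma cocycleVg g : cocycle g^-1%g g = cocycle g g^-1%g.
Proof.
have := cocycleP g g^-1%g g; rewrite mulgV mulVg cocycle1g cocycleg1 addrC.
by move/addrI.
Qed.

Definition extension : Type := (bar_coker * G)%type.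

HB.instance Definition _ := Choice.on extension.

Definition ext_mul (x y : extension) : extension :=
  (x.1 + y.1 + cocycle x.2 y.2, (x.2 * y.2)%g).
Definition ext_one : extension := (- cocycle 1%g 1%g, 1%g).
Definition ext_inv (x : extension) : extension :=
  (- x.1 - cocycle x.2^-1%g x.2 - cocycle 1%g 1%g, x.2^-1%g).

Fact ext_mulA : associative ext_mul.
Proof.
case=> u g [v h] [w k]; rewrite /ext_mul /= mulgA; congr (_, _).
rewrite (addrAC _ (cocycle g h) w) -[RHS]addrA cocycleP !addrA.
by rewrite [LHS]addrAC.
Qed.

Fact ext_mul1 : left_id ext_one ext_mul.
Proof.
by case=> u g; rewrite /ext_mul /= mul1g cocycle1g addrAC addNr add0r.
Qed.

Fact ext_mulr1 : right_id ext_one ext_mul.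
Proof. by case=> u g; rewrite /ext_mul /= mulg1 cocycleg1 subrK. Qed.

Fact ext_mulV : left_inverse ext_one ext_inv ext_mul.
Proof.
case=> u g; rewrite /ext_mul /ext_one /= mulVg; congr (_, _).
by rewrite -addrA -[- u - _]opprD addrAC addNr add0r.
Qed.

Fact ext_mulrV : right_inverse ext_one ext_inv ext_mul.
Proof.
case=> u g; rewrite /ext_mul /ext_one /= mulgV; congr (_, _).
by rewrite !addrA subrr add0r cocycleVg addrAC addNr add0r.
Qed.

HB.instance Definition _ := isGroup.Build extension ext_mulA ext_mul1 ext_mulr1
  ext_mulV ext_mulrV.

(** Since the unit is [ext_one], subtracting [cocycle 1 1] makes this a morphism. *)
Definition ext_central (u : bar_coker) : extension :=
  (u - cocycle 1%g 1%g, 1%g).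

Lemma ext_mulE (u v : bar_coker) (g h : G) :
  (((u, g) : extension) * ((v, h) : extension))%g
  = (u + v + cocycle g h, (g * h)%g) :> extension.
Proof. by []. Qed.

Lemma ext_mul2 (x y : extension) : (x * y)%g.2 = (x.2 * y.2)%g.
Proof. by []. Qed.

Lemma ext_centralE u (x : extension) : (ext_central u * x)%g = (u + x.1, x.2).
Proof.
by case: x => v g; rewrite ext_mulE mul1g cocycle1g addrAC subrK.
Qed.

Lemma ext_centralC u (x : extension) : commute (ext_central u) x.
Proof.
case: x => v g; rewrite /commute ext_centralE ext_mulE mulg1 cocycleg1.
by rewrite addrA subrK addrC.
Qed.

Lemma ext_centralD u v :
  ext_central (u + v) = (ext_central u * ext_central v)%g.
Proof. by rewrite ext_centralE /= addrA. Qed.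

Lemma ext_central0 : ext_central 0 = 1%g.
Proof. by rewrite /ext_central sub0r. Qed.

Lemma ext_central_inj : injective ext_central.
Proof. by move=> u v [/addIr]. Qed.

Lemma ext_fiber (x y : extension) :
  x.2 = y.2 -> exists u, x = (ext_central u * y)%g.
Proof.
case: x y => u g [v h] /= ->; exists (u - v).
by rewrite ext_centralE /= subrK.
Qed.

Lemma bar_d1_boundary y : bar_d (bar_d y : bar_chain G 2) = 0 :> bar_chain G 1.
Proof.
pose f := \0 : {additive bar_chain G 3 -> bar_chain G 1}.
apply: (@freeg_additive_eq _ _ (@bar_d G 1 \o @bar_d G 2) f) => z.
rewrite [z]tuple3E /f /= bar_d2E !(raddfB, raddfD) /= !bar_d1E mulgA.
rewrite !opprD !opprK !addrA.
rewrite [LHS](ACl (1*4*(2*7)*(3*10)*(5*8)*(6*11)*(9*12)))%AC /=.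
by rewrite !subrr !addNr !addr0.
Qed.

Section CokerLift.
Variables (A : zmodType) (f : {additive bar_chain G 2 -> A}).
Hypothesis fd : forall y : bar_chain G 3, f (bar_d y) = 0.

Definition coker_lift (u : bar_coker) : A := f (repr u).

Lemma coker_liftE x : coker_lift (coker_pi x) = f x.
Proof.
apply/eqP; rewrite -subr_eq0 -raddfB; apply/eqP.
have /coker_pi_eq0[y <-] : coker_pi (repr (coker_pi x) - x) = 0.
  by rewrite raddfB /= {1}/coker_pi reprK subrr.
exact: fd.
Qed.

Lemma coker_lift_is_zmod_morphism : zmod_morphism coker_lift.
Proof.
move=> u v; have [x ->] := coker_pi_surj u; have [y ->] := coker_pi_surj v.
by rewrite -raddfB !coker_liftE raddfB.
Qed.

End CokerLift.

Definition coker_d : bar_coker -> bar_chain G 1 := coker_lift (@bar_d G 1).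

Lemma coker_dE x : coker_d (coker_pi x) = bar_d x.
Proof. exact/coker_liftE/bar_d1_boundary. Qed.

Lemma coker_d_is_zmod_morphism : zmod_morphism coker_d.
Proof. exact/coker_lift_is_zmod_morphism/bar_d1_boundary. Qed.

HB.instance Definition _ :=
  GRing.isZmodMorphism.Build _ _ coker_d coker_d_is_zmod_morphism.

Lemma coker_d_cocycle g h :
  coker_d (cocycle g h)
  = << [tuple h] >> - << [tuple (g * h)%g] >> + << [tuple g] >>.
Proof. by rewrite coker_dE bar_d1E. Qed.

(* A morphism to the abelian group Z[G], which extends the differential: this is
   how commutators and quotients of conjugates are seen to be cycles. *)
Definition ext_degree (x : extension) : bar_chain G 1 :=
  coker_d x.1 + << [tuple x.2] >>.

Lemma ext_degreeM x y : ext_degree (x * y)%g = ext_degree x + ext_degree y.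
Proof.
rewrite /ext_degree /= !raddfD /= coker_d_cocycle.
rewrite -!addrA; congr (_ + _); rewrite [RHS]addrCA; congr (_ + _).
by rewrite !addrA [LHS](ACl (3*1*(2*4)))%AC /= addNr addr0.
Qed.

Lemma ext_degree_central u : ext_degree (ext_central u) = coker_d u.
Proof.
by rewrite /ext_degree /= raddfB /= coker_d_cocycle mul1g subrr add0r subrK.
Qed.

End LowDegree.

(** * An upper bound from a presentation *)

Section WordEval.
Variables (X : choiceType) (H : groupType) (q : X -> H).
Local Open Scope group_scope.

Definition letter_eval (x : X * bool) : H := if x.2 then (q x.1)^-1 else q x.1.

Definition word_eval (w : word X) : H :=
  foldr (fun x a => letter_eval x * a) 1 w.

Lemma word_eval_cat u v : word_eval (u ++ v) = word_eval u * word_eval v.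
Proof. by elim: u => [|x u IHu] /=; rewrite ?mul1g // IHu mulgA. Qed.

End WordEval.

Section PresentedGroup.
Variables (X : choiceType) (R : seq X -> seq X -> Prop).
Local Notation G := (presented_group R).

Definition pgen (x : X) : G := \pi_G [:: (x, false)].

Lemma pi_word_eval (w : word X) : \pi_G w = word_eval pgen w.
Proof.
elim: w => [|[x b] w IHw] //=; rewrite -IHw -[(x, b) :: w]cat1s -presented_mulE.
congr (_ * _)%g; case: b => //; rewrite /letter_eval /=.
by rewrite [in RHS]/pgen; exact/esym/presented_invE.
Qed.

Lemma presented_rel s t :
  R s t -> word_eval pgen (posword s) = word_eval pgen (posword t).
Proof. by rewrite -!pi_word_eval => st; apply/eq_presented/WordRel. Qed.

Local Notation E := (extension G).

Variables (q : X -> E) (H : {pred bar_coker G}).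
Hypothesis H_closed : zmod_closed H.
Hypothesis q2 : forall x, (q x).2 = pgen x.
Hypothesis q_rel : forall s t, R s t -> exists2 h, h \in H &
  word_eval q (posword s) = (ext_central h * word_eval q (posword t))%g.

Lemma word_eval2 w : (word_eval q w).2 = \pi_G w.
Proof.
rewrite pi_word_eval; elim: w => [|[x b] w IHw] //=.
by rewrite IHw; case: b; rewrite /letter_eval /= q2.
Qed.

Let H0 : 0 \in H. Proof. by case: H_closed. Qed.
Let HB : {in H &, forall u v, u - v \in H}. Proof. by case: H_closed. Qed.
Let HN : {in H, forall u, - u \in H}.
Proof. by move=> u Hu; rewrite -sub0r HB. Qed.
Let HD : {in H &, forall u v, u + v \in H}.
Proof. by move=> u v Hu Hv; rewrite -[v]opprK HB ?HN. Qed.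

(** The defects of the relations are central, so they can be moved to the front and add up along a
    derivation. *)
Lemma word_eval_eqv u v : word_eqv R u v -> exists2 h, h \in H &
  word_eval q u = (ext_central h * word_eval q v)%g.
Proof.
elim=> {u v}.
- by move=> u; exists 0; rewrite // ext_central0 mul1g.
- move=> u v _ [h Hh ->]; exists (- h); first exact: HN.
  by rewrite mulgA -ext_centralD addNr ext_central0 mul1g.
- move=> u v w _ [h Hh ->] _ [k Hk ->]; exists (h + k); first exact: HD.
  by rewrite mulgA -ext_centralD.
- move=> u u' v v' _ [h Hh eu] _ [k Hk ev]; exists (h + k); first exact: HD.
  rewrite !word_eval_cat eu ev ext_centralD -!mulgA; congr (_ * _)%g.
  by rewrite !mulgA (ext_centralC k).
- move=> x b; exists 0; rewrite // ext_central0 mul1g /= mulg1.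
  by case: b; rewrite /letter_eval /= ?mulVg ?mulgV.
- exact: q_rel.
Qed.

(* If the relations lift modulo H, the universal cocycle becomes a coboundary
   modulo H. *)
Lemma coker_ker_sub u : coker_d u = 0 -> u \in H.
Proof.
(* The words [repr g] give a section of the extension over G; [c] is its first component. *)
pose c (g : G) := (word_eval q (repr g)).1.
pose C : {additive bar_chain G 1 -> bar_coker G} :=
  freeg_ext (fun t : 1.-tuple G => c (tnth t 0)).
have C1 g : C << [tuple g] >> = c g by rewrite /C /= freeg_extU.
(* The section is multiplicative modulo H, which expresses the cocycle through [C] modulo H. *)
have cE g h : cocycle g h + C (coker_d (cocycle g h)) \in H.
  have [k Hk] : exists2 k, k \in H & word_eval q (repr (g * h)%g) =
      (ext_central k * word_eval q (repr g ++ repr h))%g.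
    by apply: word_eval_eqv; exact: repr_presented.
  rewrite word_eval_cat ext_centralE => /(congr1 fst) /= ck.
  rewrite coker_d_cocycle raddfD raddfB /= !C1 {2}/c ck !word_eval2 !reprK.
  suff -> : cocycle g h + (c h - (k + (c g + c h + cocycle g h)) + c g) = - k
    by exact: HN.
  rewrite !opprD !addrA.
  by rewrite [LHS](ACl (3*(1*6)*(2*5)*(4*7)))%AC /= !subrr addNr !addr0.
have main x : coker_pi x + C (bar_d x) \in H.
  rewrite -(freeg_sumE x) !raddf_sum -big_split /=.
  apply: (big_ind (fun u => u \in H)) => // t _.
  rewrite -[coeff t x]intz -freegU_mulz !raddfMz /= -mulrzDl.
  set n := coeff t x; set w := (X in X *~ n).
  have Hw : w \in H.
    rewrite /w [t]tuple2E.
    by have := cE (tnth t 0) (tnth t 1); rewrite coker_dE.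
  have Hn m : w *+ m \in H by elim: m => [|m IHm]; rewrite ?mulr0n // mulrS HD.
  by case: n => m; [exact: Hn | rewrite NegzE mulrNz HN // Hn].
(* On a cycle the term [C (bar_d x)] vanishes, which leaves u itself in H. *)
have [x ->] := coker_pi_surj u; rewrite coker_dE => dx.
by have := main x; rewrite dx raddf0 addr0.
Qed.

End PresentedGroup.

(** * Classes detected by skew actions *)

(* The letters act on A * V by skew products, for which the relations hold only
   up to translations of A; these translations define a 2-cocycle. *)
Section SkewAction.
Variables (X : choiceType) (A : zmodType) (V : Type).
Variables (wt : X -> V -> A) (mv mv' : X -> V -> V).

Definition letter_act (x : X * bool) (p : A * V) : A * V :=
  if x.2 then (p.1 - wt x.1 (mv' x.1 p.2), mv' x.1 p.2)
  else (p.1 + wt x.1 p.2, mv x.1 p.2).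

(** Because of [foldr] the last letter acts first, as in a left action. *)
Definition word_act (w : word X) (p : A * V) : A * V := foldr letter_act p w.

Definition shift (a : A) (p : A * V) : A * V := (a + p.1, p.2).

Lemma shiftD a b p : shift (a + b) p = shift a (shift b p).
Proof. by rewrite /shift /= addrA. Qed.

Lemma shift0 p : shift 0 p = p.
Proof. by case: p => a v; rewrite /shift /= add0r. Qed.

Lemma word_act_cat u v p : word_act (u ++ v) p = word_act u (word_act v p).
Proof. exact: foldr_cat. Qed.

Lemma letter_act_shift x a p :
  letter_act x (shift a p) = shift a (letter_act x p).
Proof. by case: x => x []; rewrite /letter_act /shift /= addrA. Qed.

Lemma word_act_shift w a p : word_act w (shift a p) = shift a (word_act w p).
Proof. by elim: w => //= x w ->; exact: letter_act_shift. Qed.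

Variable R : seq X -> seq X -> Prop.
Local Notation G := (presented_group R).
Local Notation E := (extension G).

Hypothesis mvK : forall x, cancel (mv x) (mv' x).
Hypothesis mv'K : forall x, cancel (mv' x) (mv x).
Hypothesis act_rel : forall s t, R s t -> exists a,
  forall p, word_act (posword s) p = shift a (word_act (posword t) p).

Lemma word_act_eqv u v : word_eqv R u v ->
  exists a, forall p, word_act u p = shift a (word_act v p).
Proof.
elim=> {u v}.
- by move=> u; exists 0 => p; rewrite shift0.
- move=> u v _ [a uv]; exists (- a) => p.
  by rewrite uv -shiftD addNr shift0.
- move=> u v w _ [a uv] _ [b vw]; exists (a + b) => p.
  by rewrite uv vw shiftD.
- move=> u u' v v' _ [a uu] _ [b vv]; exists (a + b) => p.
  by rewrite !word_act_cat vv word_act_shift uu -shiftD addrC.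
- move=> x b; exists 0 => -[a v]; rewrite shift0.
  by case: b; rewrite /word_act /= /letter_act /= ?mvK ?mv'K ?addrK ?subrK.
- exact: act_rel.
Qed.

Variable v0 : V.
Let p0 : A * V := (0, v0).

(** Two words for the same element differ by a single translation, so evaluating at [p0] loses
    nothing; see [act_cocycleE]. *)
Definition act_cocycle (g h : G) : A :=
  (word_act (repr g ++ repr h) p0).1 - (word_act (repr (g * h)%g) p0).1.

Lemma act_cocycleE g h p : word_act (repr g) (word_act (repr h) p)
  = shift (act_cocycle g h) (word_act (repr (g * h)%g) p).
Proof.
have [a ae] : exists a, forall p, word_act (repr g ++ repr h) p
    = shift a (word_act (repr (g * h)%g) p).
  by apply/word_act_eqv/WordSym/repr_presented.
by rewrite -word_act_cat ae /act_cocycle ae /= addrK.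
Qed.

Lemma act_cocycleP g h k :
  act_cocycle g h + act_cocycle (g * h)%g k
  = act_cocycle g (h * k)%g + act_cocycle h k.
Proof.
have := act_cocycleE g h (word_act (repr k) p0).
rewrite (act_cocycleE h k) word_act_shift !act_cocycleE -!shiftD mulgA.
by case=> /addIr; rewrite addrC.
Qed.

Definition act_cochain : {additive bar_chain G 2 -> A} :=
  freeg_ext (fun t : 2.-tuple G => act_cocycle (tnth t 0) (tnth t 1)).

Lemma act_cochainE g h : act_cochain << [tuple g; h] >> = act_cocycle g h.
Proof. by rewrite /act_cochain /= freeg_extU. Qed.

Lemma act_cochain_d (y : bar_chain G 3) : act_cochain (bar_d y) = 0.
Proof.
pose f := \0 : {additive bar_chain G 3 -> A}.
apply: (@freeg_additive_eq _ _ (act_cochain \o @bar_d G 2) f) => z.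
rewrite [z]tuple3E /f [LHS]/= bar_d2E !(raddfB, raddfD) !act_cochainE /=.
by apply/eqP; rewrite subr_eq0 addrAC subr_eq act_cocycleP addrC.
Qed.

Definition act_class_fun : bar_coker G -> A := coker_lift act_cochain.

Lemma act_class_fun_is_zmod_morphism : zmod_morphism act_class_fun.
Proof. exact/coker_lift_is_zmod_morphism/act_cochain_d. Qed.

HB.instance Definition _ :=
  GRing.isZmodMorphism.Build _ _ act_class_fun act_class_fun_is_zmod_morphism.

Definition act_class : {additive bar_coker G -> A} := act_class_fun.

Lemma act_class_cocycle g h : act_class (cocycle g h) = act_cocycle g h.
Proof.
rewrite /act_class /= /act_class_fun coker_liftE ?act_cochainE //.
exact: act_cochain_d.
Qed.

(** The class absorbs the translations by which words fail to act: the extension acts honestly, the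
    central [bar_coker] through translations by [act_class]. *)
Definition ext_act (x : E) p := shift (act_class x.1) (word_act (repr x.2) p).

Lemma ext_actM x y p : ext_act (x * y)%g p = ext_act x (ext_act y p).
Proof.
rewrite /ext_act /= word_act_shift act_cocycleE -!shiftD !raddfD /=.
by rewrite act_class_cocycle.
Qed.

Lemma ext_act_central u p : ext_act (ext_central u) p = shift (act_class u) p.
Proof.
have [a ae] : exists a, forall p, word_act (repr (1%g : G)) p = shift a p.
  have [a ae] := word_act_eqv (repr_presented R [::]).
  by exists a => p'; rewrite ae.
have := act_cocycleE 1%g 1%g p0.
rewrite !mul1g !ae -!shiftD => -[/addIr/addIr aE].
by rewrite /ext_act /= ae -shiftD raddfB /= act_class_cocycle aE subrK.
Qed.

Variable q : X -> E.
Hypothesis q2 : forall x, (q x).2 = pgen R x.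

Definition act_offset x := (ext_act (q x) p0).1 - (letter_act (x, false) p0).1.

Lemma ext_act_letter x p :
  ext_act (q x) p = shift (act_offset x) (letter_act (x, false) p).
Proof.
have [a ae] : exists a, forall p,
    ext_act (q x) p = shift a (letter_act (x, false) p).
  have [a ae] := word_act_eqv (repr_presented R [:: (x, false)]).
  by exists (act_class (q x).1 + a) => r; rewrite /ext_act q2 ae -shiftD.
by rewrite ae /act_offset ae /= addrK.
Qed.

Lemma ext_act_word s p : ext_act (word_eval q (posword s)) p =
  shift (\sum_(x <- s) act_offset x) (word_act (posword s) p).
Proof.
elim: s => [|x s IHs] /=.
  by rewrite -ext_central0 ext_act_central raddf0 big_nil.
by rewrite ext_actM IHs ext_act_letter big_cons shiftD letter_act_shift.
Qed.

(** Letting both sides of a lifted relation act on [p0] reads off the class of its defect, up to the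
    offsets between lifts and letters. *)
Lemma act_class_rel s t u a :
    (forall p, word_act (posword s) p = shift a (word_act (posword t) p)) ->
    word_eval q (posword s) = (ext_central u * word_eval q (posword t))%g ->
  act_class u + \sum_(x <- t) act_offset x = \sum_(x <- s) act_offset x + a.
Proof.
move=> ae /(congr1 (fun x => ext_act x p0)).
rewrite ext_actM !ext_act_word ext_act_central ae -!shiftD.
by case=> /addIr.
Qed.

End SkewAction.

(** * Lifting the braid relations *)

Section BraidRelation.
Variable H : groupType.
Implicit Types x y z : H.
Local Open Scope group_scope.

Lemma braid_conj x y : x * y * x = y * x * y -> x = y ^ (x * y).
Proof. by move=> xy; rewrite conjgE [y * _]mulgA -xy mulKg. Qed.

Lemma conj_braid x y : x = y ^ (x * y) -> x * y * x = y * x * y.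
Proof. by move=> {2}->; rewrite conjgE mulVKg mulgA. Qed.

(* In the braid group on four strands, this is the half twist exchanging the
   two outer generators. *)
Lemma braid_swap x y z : commute x y ->
  x * z * x = z * x * z -> y * z * y = z * y * z ->
  x ^ (z * x * y * z) = y.
Proof.
move=> xy xz yz; apply: (mulgI (z * x * y * z)).
rewrite conjgE mulVKg !mulgA xz -(mulgA (z * x)) -(mulgA (z * x)) -yz.
by rewrite !mulgA.
Qed.

Lemma braid_pair_conj x y z :
    z * x * z = x * z * x -> z * y * z = y * z * y ->
  x ^ (z * (x * y) * z) = y.
Proof.
move=> zx zy; apply: (mulgI (z * (x * y) * z)); rewrite conjgE mulVKg.
have -> : z * (x * y) * z * y = z * x * (y * z * y) by rewrite !mulgA.
by rewrite -zy !mulgA zx.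
Qed.

End BraidRelation.

(** * Conjugation and commutators in the extension *)

Section Extension.
Variable G : groupType.
Local Notation E := (extension G).
Implicit Types (x y : E) (g h k : G).

(** Two elements with the same image differ by a central factor, to which conjugation is blind. *)
Lemma ext_conj2 z x y : x.2 = y.2 -> (z ^ x = z ^ y)%g.
Proof.
move=> /ext_fiber[u ->]; rewrite !conjgE; apply: (mulgI (ext_central u * y)%g).
by rewrite mulVKg -!mulgA mulVKg mulgA ext_centralC -!mulgA ext_centralC mulgA.
Qed.

Lemma ext_conj_central u x : (ext_central u ^ x = ext_central u)%g.
Proof. by rewrite conjgE ext_centralC mulKg. Qed.

Lemma ext_degree1 : ext_degree (1%g : E) = 0.
Proof. by rewrite -(ext_central0 G) ext_degree_central raddf0. Qed.

Lemma ext_degreeV x : ext_degree x^-1%g = - ext_degree x.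
Proof.
by apply: (addIr (ext_degree x)); rewrite -ext_degreeM mulVg ext_degree1 addNr.
Qed.

Lemma ext_degreeJ x y : ext_degree (x ^ y)%g = ext_degree x.
Proof. by rewrite conjgE !ext_degreeM ext_degreeV addrC addrK. Qed.

Definition ext_lift g : E := (0, g).

(** The lifts are arbitrary, and for commuting g and h the commutator does not depend on them, by
    [comm_classE]; the added term undoes the shift in [ext_central]. *)
Definition comm_class g h : bar_coker G :=
  [~ ext_lift g, ext_lift h]%g.1 + cocycle 1%g 1%g.

Lemma comm_class_def g h : commute g h ->
  [~ ext_lift g, ext_lift h]%g = ext_central (comm_class g h).
Proof.
move=> gh; rewrite /ext_central addrK [LHS]surjective_pairing; congr (_, _).
by change ([~ g, h]%g = 1%g); apply/eqP/commgP.
Qed.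

Lemma comm_classE x y : commute x.2 y.2 ->
  [~ x, y]%g = ext_central (comm_class x.2 y.2).
Proof.
move=> xy; rewrite -comm_class_def //.
have [u {1}->] : exists u, x = (ext_central u * ext_lift x.2)%g.
  exact: ext_fiber.
rewrite commgEl -(@ext_conj2 _ (ext_lift y.2)) // conjMg ext_conj_central.
by rewrite invgM -!mulgA mulKg -commgEl.
Qed.

Lemma comm_classP x y : commute x.2 y.2 ->
  (x * y = ext_central (comm_class x.2 y.2) * (y * x))%g.
Proof. by move=> xy; rewrite commgC comm_classE // ext_centralC. Qed.

Lemma comm_classJ g h k :
  commute g h -> comm_class (g ^ k)%g (h ^ k)%g = comm_class g h.
Proof.
move=> gh; apply: ext_central_inj.
rewrite -[RHS](ext_conj_central _ (ext_lift k)).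
rewrite -[in RHS]comm_class_def // conjRg [RHS]comm_classE //.
by rewrite /commute /= -!conjMg gh.
Qed.

Lemma comm_classV g h : commute g h -> comm_class h g = - comm_class g h.
Proof.
move=> gh; apply: ext_central_inj.
apply: (mulgI (ext_central (comm_class g h))).
rewrite -[RHS]ext_centralD subrr ext_central0 -!comm_class_def //.
by rewrite -invgR mulVg.
Qed.

Lemma comm_class_degree g h : commute g h -> coker_d (comm_class g h) = 0.
Proof.
move=> gh; rewrite -ext_degree_central -comm_class_def // commgEl.
by rewrite ext_degreeM ext_degreeJ ext_degreeV addNr.
Qed.

(** The braid relation makes h the conjugate of k by h k, and h k commutes with g. *)
Lemma comm_class_braid g h k : commute g h -> commute g k ->
  (h * k * h = k * h * k)%g -> comm_class g h = comm_class g k.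
Proof.
move=> gh gk hk; rewrite -(comm_classJ (h * k)%g gk) -braid_conj //.
by rewrite conjgE (commuteM gh gk) mulKg.
Qed.

(** The half twist [k * g * h * k] exchanges g and h, while exchanging them negates the class. *)
Lemma comm_class_swap g h k : commute g h ->
    (g * k * g = k * g * k)%g -> (h * k * h = k * h * k)%g ->
  comm_class g h *+ 2 = 0.
Proof.
move=> gh gk hk; rewrite mulr2n; apply/eqP; rewrite addr_eq0; apply/eqP.
rewrite -comm_classV // -(comm_classJ (k * g * h * k)%g gh).
rewrite braid_swap //; congr comm_class.
by rewrite -(mulgA k) gh mulgA braid_swap.
Qed.

(* Conjugation in the extension depends only on images in G: lifting g as a
   conjugate of x makes the braid relation between the lifts hold exactly. *)
Definition braid_lift x g : E := (x ^ (ext_lift (x.2 * g))^-1)%g.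

Lemma braid_lift2 x g :
  (x.2 * g * x.2 = g * x.2 * g)%g -> (braid_lift x g).2 = g.
Proof.
move=> xg; change (x.2 ^ (x.2 * g)^-1 = g)%g.
by rewrite {1}(braid_conj xg) conjgK.
Qed.

Lemma braid_liftP x g : (x.2 * g * x.2 = g * x.2 * g)%g ->
  (x * braid_lift x g * x = braid_lift x g * x * braid_lift x g)%g.
Proof.
move=> xg; apply: conj_braid; set z := braid_lift x g.
rewrite (@ext_conj2 _ (x * z)%g (ext_lift (x.2 * g))).
  by rewrite /z /braid_lift conjgKV.
by rewrite -/(braid_lift x g) ext_mul2 braid_lift2.
Qed.

Lemma braid_lift_degree x g : ext_degree (braid_lift x g) = ext_degree x.
Proof. exact: ext_degreeJ. Qed.

End Extension.

(** * Lifts of the generators of B(e,e,r) *)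

Section BraidGenerators.
Variables e r : nat.

Lemma s_index_bounds (k : s_index r) : (3 <= val k <= r)%N.
Proof. by case: k => k h /=; have := ltn_ord k; lia. Qed.

Hypothesis hr : (3 <= r)%N.
Local Notation G := (presented_group (@braid_rel e r)).
Local Notation E := (extension G).
Local Notation U := (bar_coker G).

Fact s_idx_subproof k : (3 <= (inord (minn (maxn 3 k) r) : 'I_r.+1))%N.
Proof. by rewrite inordK; lia. Qed.

(* Indices outside [3, r] are clamped. *)
Definition s_idx k : s_index r :=
  exist (fun k : 'I_r.+1 => (3 <= k)%N) _ (s_idx_subproof k).

Lemma s_idxE k : (3 <= k <= r)%N -> val (s_idx k) = k :> nat.
Proof. by move=> hk; rewrite inordK; lia. Qed.

Lemma s_idxK (k : s_index r) : s_idx (val k) = k.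
Proof.
have hk := s_index_bounds k.
by apply/val_inj/val_inj; rewrite /= s_idxE.
Qed.

Definition gt (i : 'I_e) : G := pgen _ (inl i).
Definition gs (k : nat) : G := pgen _ (inr (s_idx k)).

Local Open Scope group_scope.

Lemma gtt i j : gt (ordS i) * gt i = gt (ordS j) * gt j.
Proof. by have /presented_rel := BraidTT r i j; rewrite /= !mulg1. Qed.

Lemma gs3t i : gs 3 * gt i * gs 3 = gt i * gs 3 * gt i.
Proof.
have /(BraidS3T i)/presented_rel : val (s_idx 3) = 3 :> nat by rewrite s_idxE.
by rewrite /= !mulg1 !mulgA.
Qed.

Lemma gst k i : (4 <= k <= r)%N -> commute (gs k) (gt i).
Proof.
move=> hk; have /(BraidST i)/presented_rel : (4 <= val (s_idx k))%N.
  by rewrite s_idxE; lia.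
by rewrite /= !mulg1.
Qed.

Lemma gsss k : (3 <= k < r)%N ->
  gs k * gs k.+1 * gs k = gs k.+1 * gs k * gs k.+1.
Proof.
move=> hk.
have /BraidSSS/presented_rel : val (s_idx k.+1) = (val (s_idx k)).+1 :> nat.
  by rewrite !s_idxE; lia.
by move/(_ e); rewrite /= !mulg1 !mulgA.
Qed.

Lemma gss k l : (3 <= k)%N -> (k + 2 <= l <= r)%N -> commute (gs k) (gs l).
Proof.
move=> hk hl.
have /BraidSS/presented_rel : (val (s_idx k) + 2 <= val (s_idx l))%N.
  by rewrite !s_idxE; lia.
by move/(_ e); rewrite /= !mulg1.
Qed.

(** The index is shifted by 3: [s_lift n] is meant to lie over s_(n+3). Each lift is a conjugate of
    the preceding one, for the sake of exact braid relations. *)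
Fixpoint s_lift n : E :=
  if n is m.+1 then braid_lift (s_lift m) (gs (m + 4)) else ext_lift (gs 3).

Lemma s_lift2 n : (n + 3 <= r)%N -> (s_lift n).2 = gs (n + 3).
Proof.
elim: n => [|n IHn] // hn; rewrite [s_lift _]/=.
have -> : (n.+1 + 3 = n + 4)%N by lia.
rewrite braid_lift2 //; rewrite IHn; last lia.
by have -> : (n + 4 = (n + 3).+1)%N; [lia | apply: gsss; lia].
Qed.

Lemma s_liftP n : (n + 3 < r)%N ->
  s_lift n * s_lift n.+1 * s_lift n = s_lift n.+1 * s_lift n * s_lift n.+1.
Proof.
move=> hn; apply: braid_liftP; rewrite s_lift2; last lia.
by rewrite !addnS gsss //; lia.
Qed.

Definition t_lift i : E := braid_lift (s_lift 0) (gt i).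

Lemma t_lift2 i : (t_lift i).2 = gt i.
Proof. exact/braid_lift2/gs3t. Qed.

Lemma t_liftP i :
  s_lift 0 * t_lift i * s_lift 0 = t_lift i * s_lift 0 * t_lift i.
Proof. exact/braid_liftP/gs3t. Qed.

Lemma t_lift_degree i : ext_degree (t_lift i) = ext_degree (s_lift 0).
Proof. exact: braid_lift_degree. Qed.

Definition gen_lift (x : braid_gen e r) : E :=
  match x with inl i => t_lift i | inr k => s_lift (val k - 3) end.

Lemma gen_lift2 x : (gen_lift x).2 = pgen _ x.
Proof.
case: x => [i|k] /=; first exact: t_lift2.
case/andP: (s_index_bounds k) => h3 hk.
by rewrite s_lift2 subnK // /gs s_idxK.
Qed.

Definition tt_lift i : E := t_lift (ordS i) * t_lift i.

Lemma tt_lift2 i j : (tt_lift i).2 = (tt_lift j).2.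
Proof.
rewrite /tt_lift [LHS]ext_mul2 [RHS]ext_mul2 !t_lift2; exact: gtt.
Qed.

(** By [ext_conj2] only the image of t_(j+1) t_j matters, and it does not depend on j; so j may be
    replaced by i. *)
Lemma t_lift_conj i j :
  t_lift (ordS i) ^ (s_lift 0 * tt_lift j * s_lift 0) = t_lift i.
Proof.
rewrite (@ext_conj2 _ _ _ (s_lift 0 * tt_lift i * s_lift 0)); last first.
  rewrite (ext_mul2 _ (s_lift 0)) (ext_mul2 (s_lift 0)).
  by rewrite (ext_mul2 _ (s_lift 0)) (ext_mul2 (s_lift 0)) (tt_lift2 i j).
exact: (braid_pair_conj (t_liftP _) (t_liftP _)).
Qed.

Hypothesis he : (0 < e)%N.

Definition i0 : 'I_e := Ordinal he.

Definition tt_class : U := ((tt_lift (ordS i0)).1 - (tt_lift i0).1)%R.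

Lemma tt_lift_diff i : tt_lift (ordS i) =
  ext_central ((tt_lift (ordS i)).1 - (tt_lift i).1)%R * tt_lift i.
Proof.
rewrite ext_centralE subrK; move: (tt_lift2 (ordS i) i).
by case: (tt_lift _) => u g; case: (tt_lift _) => v h /= ->.
Qed.

Lemma tt_lift_conj i j :
  tt_lift (ordS i) ^ (s_lift 0 * tt_lift j * s_lift 0) = tt_lift i.
Proof. by rewrite [tt_lift (ordS i)]/tt_lift conjMg !t_lift_conj. Qed.

(* Conjugation by s_3 t_1 t_0 s_3 shifts the indices, so that the defect of
   t_(i+1) t_i = t_i t_(i-1) in the extension does not depend on i. *)
Lemma tt_lift_step i u : tt_lift (ordS i) = ext_central u * tt_lift i ->
  tt_lift (ordS (ordS i)) = ext_central u * tt_lift (ordS i).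
Proof.
move=> hi; apply: (conjg_inj (s_lift 0 * tt_lift i0 * s_lift 0)).
by rewrite tt_lift_conj hi conjMg ext_conj_central -hi tt_lift_conj.
Qed.

Lemma ord_iter (i : 'I_e) : i = iter i (@ordS e) i0.
Proof.
suff h n : (n < e)%N -> val (iter n (@ordS e) i0) = n.
  exact/val_inj/esym/h/ltn_ord.
elim: n => //= n IHn hn; rewrite IHn ?modn_small //; exact: ltnW.
Qed.

Lemma iter_ordS : iter e (@ordS e) i0 = i0.
Proof.
suff h n : n.+1 = e -> iter n.+1 (@ordS e) i0 = i0.
  by have := h e.-1; rewrite prednK //; apply.
move=> ne; have hn : (n < e)%N by rewrite -ne.
rewrite iterS -[n in iter n]/(nat_of_ord (Ordinal hn)) -ord_iter.
by apply: val_inj; rewrite /= ne modnn.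
Qed.

Lemma tt_liftS i : tt_lift (ordS i) = ext_central tt_class * tt_lift i.
Proof.
rewrite (ord_iter i); elim: (nat_of_ord i) => [|n IHn] /=.
  exact: tt_lift_diff.
exact: tt_lift_step.
Qed.

Lemma tt_lift_iter n : tt_lift (iter n (@ordS e) i0) =
  ext_central (tt_class *+ n)%R * tt_lift i0.
Proof.
elim: n => [|n IHn] /=; first by rewrite mulr0n ext_central0 mul1g.
by rewrite tt_liftS IHn mulgA -ext_centralD mulrS.
Qed.

Lemma tt_liftE (i : 'I_e) :
  tt_lift i = ext_central (tt_class *+ i)%R * tt_lift i0.
Proof. by rewrite {1}(ord_iter i) tt_lift_iter. Qed.

(** Each step of the index multiplies by [tt_class], and e steps lead back to the start. *)
Lemma tt_class_order : (tt_class *+ e = 0)%R.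
Proof.
have := tt_lift_iter e; rewrite iter_ordS.
move=> /(congr1 (fun x => x * (tt_lift i0)^-1)); rewrite mulgV mulgK.
by rewrite -(ext_central0 G) => /ext_central_inj.
Qed.

(** All the [t_lift i] are conjugates of [s_lift 0], so all the products [tt_lift i] have the same
    degree. *)
Lemma tt_class_degree : coker_d tt_class = 0%R.
Proof.
have := congr1 (@ext_degree G) (tt_liftS i0).
rewrite ext_degreeM ext_degree_central.
rewrite /tt_lift !(ext_degreeM (t_lift _)) !t_lift_degree.
by rewrite -[LHS]add0r => /addIr.
Qed.

Lemma gen_lift_comm x y (u := pgen (@braid_rel e r) x) (v := pgen _ y) :
  commute u v -> word_eval gen_lift (posword [:: x; y]) =
    ext_central (comm_class u v) * word_eval gen_lift (posword [:: y; x]).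
Proof.
move=> uv; rewrite /word_eval /= /letter_eval /= !mulg1.
by rewrite (@comm_classP _ (gen_lift x) (gen_lift y)) !gen_lift2.
Qed.

Lemma gen_lift_braid x y :
    gen_lift x * gen_lift y * gen_lift x
    = gen_lift y * gen_lift x * gen_lift y ->
  word_eval gen_lift (posword [:: x; y; x]) =
  word_eval gen_lift (posword [:: y; x; y]).
Proof. by move=> xy; rewrite /word_eval /= /letter_eval /= !mulg1 !mulgA. Qed.

Lemma gen_lift_s3t (k : s_index r) i : val k = 3 :> nat ->
  word_eval gen_lift (posword [:: inr k; inl i; inr k]) =
  word_eval gen_lift (posword [:: inl i; inr k; inl i]).
Proof.
by move=> hk; apply: gen_lift_braid; rewrite /gen_lift hk; exact: t_liftP.
Qed.

Lemma gen_lift_tt (i j : 'I_e) :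
  word_eval gen_lift (posword [:: inl (ordS i); inl i]) =
  ext_central (tt_class *+ i - tt_class *+ j)%R *
  word_eval gen_lift (posword [:: inl (ordS j); inl j]).
Proof.
rewrite /word_eval /= /letter_eval /= !mulg1 -/(tt_lift i) -/(tt_lift j).
by rewrite (tt_liftE i) (tt_liftE j) [RHS]mulgA -ext_centralD subrK.
Qed.

(** The braid relations lift exactly, so only the relations among the t_i and the commutations
    contribute defects. *)
Lemma braid_kernel_sub (H : {pred U}) : zmod_closed H ->
    tt_class \in H ->
    (forall k i, (4 <= k <= r)%N -> comm_class (gs k) (gt i) \in H) ->
    (forall k l, (3 <= k)%N -> (k + 2 <= l <= r)%N ->
      comm_class (gs k) (gs l) \in H) ->
  forall u, coker_d u = 0%R -> u \in H.
Proof.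
move=> clH Hb Ht Hs; apply: (coker_ker_sub clH gen_lift2).
have [H0 HB] := clH.
have HN : {in H, forall u, (- u)%R \in H} by move=> u Hu; rewrite -sub0r HB.
have HD : {in H &, forall u v, (u + v)%R \in H}.
  by move=> u v Hu Hv; rewrite -[v]opprK HB ?HN.
have HM n : (tt_class *+ n)%R \in H.
  by elim: n => [|n IHn]; rewrite ?mulr0n // mulrS HD.
move=> s t [i j|k i hk|k i hk|k l hkl|k l hkl].
- exists (tt_class *+ i - tt_class *+ j)%R; first by rewrite HB ?HM.
  exact: gen_lift_tt.
- exists 0%R; first exact: H0.
  by rewrite ext_central0 mul1g gen_lift_s3t.
- exists (comm_class (gs (val k)) (gt i)).
    by apply: Ht; have := s_index_bounds k; lia.
  rewrite /gs s_idxK; apply: gen_lift_comm.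
  by rewrite -{1}(s_idxK k); apply: gst; have := s_index_bounds k; lia.
- exists 0%R; first exact: H0.
  rewrite ext_central0 mul1g; apply: gen_lift_braid; rewrite /gen_lift hkl.
  have := s_index_bounds k; have := s_index_bounds l; rewrite hkl.
  move=> /andP[_ kr] /andP[k3 _]; rewrite subSn //; apply: s_liftP.
  by rewrite subnK.
- exists (comm_class (gs (val k)) (gs (val l))).
    by apply: Hs; have := s_index_bounds k; have := s_index_bounds l; lia.
  rewrite /gs !s_idxK; apply: gen_lift_comm.
  rewrite -{1}(s_idxK k) -{1}(s_idxK l).
  by apply: gss; have := s_index_bounds k; have := s_index_bounds l; lia.
Qed.

End BraidGenerators.

(** * Commutator classes of s_4 with the t_i *)

Section Commutators.
Variables e r : nat.
Hypothesis hr : (3 <= r)%N.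
Local Notation gt := (@gt e r).
Local Notation gs := (gs e hr).
Implicit Types i j : 'I_e.

Definition st_class i := comm_class (gs 4) (gt i).

Hypothesis hr4 : (4 <= r)%N.

Lemma gs4t i : commute (gs 4) (gt i).
Proof. by apply: gst. Qed.

Lemma st_class_degree i : coker_d (st_class i) = 0.
Proof. exact/comm_class_degree/gs4t. Qed.

Lemma st_class2 i : st_class i *+ 2 = 0.
Proof.
apply: (@comm_class_swap _ _ _ (gs 3)); first exact: gs4t.
  by rewrite -gsss.
by rewrite -gs3t.
Qed.

(** As t_(i+2) t_(i+1) = t_(i+1) t_i, the element t_(i+1) t_i conjugates t_(i+2) to t_i; it commutes
    with s_4. *)
Lemma st_classSS i : st_class (ordS (ordS i)) = st_class i.
Proof.
pose d := (gt (ordS i) * gt i)%g.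
rewrite /st_class -(comm_classJ d (gs4t _)); congr comm_class.
  by rewrite conjgE (commuteM (gs4t _) (gs4t _)) mulKg.
have h : (gt (ordS (ordS i)) * d = d * gt i)%g.
  by rewrite /d mulgA (gtt _ (ordS i) i).
by rewrite conjgE h mulKg.
Qed.

Hypothesis he : (0 < e)%N.
Local Notation i0 := (i0 he).

Lemma st_class_iter n : st_class (iter n (@ordS e) i0) =
  st_class (if odd n then ordS i0 else i0).
Proof.
elim/ltn_ind: n => -[|[|n]] IHn //=; by rewrite st_classSS IHn ?negbK.
Qed.

Lemma st_classE i : st_class i = st_class (if odd i then ordS i0 else i0).
Proof. by rewrite {1}(ord_iter he i) st_class_iter. Qed.

Lemma st_class_odd i : odd e -> st_class i = st_class i0.
Proof.
move=> oe; rewrite st_classE; case: ifP => // _.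
(* For odd e, the successor of index 0 is also reached from 0 in e + 1 steps, an even number. *)
have <- : iter e.+1 (@ordS e) i0 = ordS i0 by rewrite iterS iter_ordS.
by rewrite st_class_iter /= oe.
Qed.

End Commutators.

(** * Rank at least 5: a single commutator class up to sign *)

Section CommutatorsRank5.
Variables e r : nat.
Hypothesis hr : (3 <= r)%N.
Local Notation gt := (@gt e r).
Local Notation gs := (gs e hr).
Implicit Types i j : 'I_e.

Hypothesis hr5 : (5 <= r)%N.

Lemma ts_class_r k i : (4 <= k <= r)%N ->
  comm_class (gt i) (gs k) = comm_class (gt i) (gs r).
Proof.
move=> /andP[k4].
elim: (r - k)%N {-2}k (erefl (r - k)%N) k4 => [|n IHn] {}k hk k4 kr.
  by have -> : k = r by lia.
rewrite -(IHn k.+1); try lia.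
by apply: comm_class_braid; [| |apply: gsss; lia];
  apply/commute_sym/gst; lia.
Qed.

(** For r at least 5, s_r also commutes with s_3, which is braided with t_i; so t_i may be replaced
    by s_3. *)
Lemma st_class_r k i : (4 <= k <= r)%N ->
  comm_class (gs k) (gt i) = comm_class (gs r) (gs 3).
Proof.
move=> hk; have hk' := gst hr i hk.
have hrt : commute (gs r) (gt i) by apply: gst; lia.
rewrite -[LHS]opprK -comm_classV // ts_class_r // -comm_classV ?opprK;
  last exact/commute_sym.
apply: comm_class_braid => //; last by rewrite -gs3t.
by apply/commute_sym/gss; lia.
Qed.

(** First l is moved up to r, then k down to 3; the sign comes from exchanging the arguments. *)
Lemma ss_class_r k l : (3 <= k)%N -> (k + 2 <= l <= r)%N ->
  comm_class (gs k) (gs l) = - comm_class (gs r) (gs 3).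
Proof.
move=> k3 hl; have -> : comm_class (gs k) (gs l) = comm_class (gs k) (gs r).
  case/andP: hl.
  elim: (r - l)%N {-2}l (erefl (r - l)%N) => [|n IHn] {}l hl kl lr.
    by have -> : l = r by lia.
  rewrite -(IHn l.+1); try lia.
  by apply: comm_class_braid; [| |apply: gsss; lia]; apply: gss; lia.
rewrite comm_classV; last by apply/commute_sym/gss; lia.
congr (- _); have : (k + 2 <= r)%N by lia.
elim: k k3 {hl} => // k IHk k3 hk; case: (eqVneq k 2) => [->//|k2].
rewrite -IHk; try lia.
apply: comm_class_braid; last by rewrite gsss //; lia.
  by apply/commute_sym/gss; lia.
by apply/commute_sym/gss; lia.
Qed.

End CommutatorsRank5.

(** * Evaluation of the detecting classes *)

Section Values.
Variables (e r : nat) (A : zmodType) (V : Type).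
Hypothesis he : (0 < e)%N.
Hypothesis hr : (3 <= r)%N.
Local Notation X := (braid_gen e r).
Local Notation R := (@braid_rel e r).
Local Notation G := (presented_group R).
Variables (wt : X -> V -> A) (mv mv' : X -> V -> V) (v0 : V).
Hypothesis mvK : forall x, cancel (mv x) (mv' x).
Hypothesis mv'K : forall x, cancel (mv' x) (mv x).
Local Notation act := (word_act wt mv mv').
Hypothesis act_rel : forall s t, R s t -> exists a,
  forall p, act (posword s) p = shift a (act (posword t) p).
Local Notation cls := (act_class mvK mv'K act_rel v0).
Local Notation rel := (act_class_rel mvK mv'K act_rel v0 (gen_lift2 hr)).

(** Both words have the same letters, so the offsets cancel. *)
Lemma act_class_comm x y a :
    commute (pgen R x) (pgen R y) ->
    (forall p,
      act (posword [:: x; y]) p = shift a (act (posword [:: y; x]) p)) ->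
  cls (comm_class (pgen R x) (pgen R y)) = a.
Proof.
move=> xy ha; have := rel ha (gen_lift_comm hr xy).
rewrite !big_cons big_nil !addr0 addrC [X in X + _]addrC => /addrI.
exact.
Qed.

Hypothesis act_s3t : forall (k : s_index r) i, val k = 3 :> nat -> forall p,
  act (posword [:: inr k; inl i; inr k]) p
  = act (posword [:: inl i; inr k; inl i]) p.

(** The relation s_3 t_j s_3 = t_j s_3 t_j is exact both in the lifts and in the action. This forces
    every t_j to have the offset of s_3, so the offsets cancel here too. *)
Lemma act_class_tt a (i := i0 he) :
    (forall p, act (posword [:: inl (ordS (ordS i)); inl (ordS i)]) p
             = shift a (act (posword [:: inl (ordS i); inl i]) p)) ->
  cls (tt_class hr he) = a.
Proof.
move=> ha; pose o x := act_offset mvK mv'K act_rel v0 (gen_lift hr) x.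
have ot j : o (inl j) = o (inr (s_idx hr 3)).
  have h3 : val (s_idx hr 3) = 3 :> nat by rewrite s_idxE.
  have h1 p : act (posword [:: inr (s_idx hr 3); inl j; inr (s_idx hr 3)]) p
      = shift 0 (act (posword [:: inl j; inr (s_idx hr 3); inl j]) p).
    by rewrite shift0 act_s3t.
  have h2 : word_eval (gen_lift hr)
      (posword [:: inr (s_idx hr 3); inl j; inr (s_idx hr 3)])
    = (ext_central 0 * word_eval (gen_lift hr)
      (posword [:: inl j; inr (s_idx hr 3); inl j]))%g.
    by rewrite ext_central0 mul1g gen_lift_s3t.
  have := rel h1 h2; rewrite raddf0 add0r addr0 !big_cons big_nil !addr0.
  by rewrite [RHS]addrCA => /addrI/addrI.
have e1 : word_eval (gen_lift hr)
      (posword [:: inl (ordS (ordS i)); inl (ordS i)])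
    = (ext_central (tt_class hr he) *
       word_eval (gen_lift hr) (posword [:: inl (ordS i); inl i]))%g.
  rewrite /word_eval /= /letter_eval /= !mulg1; exact: tt_liftS.
have := rel ha e1; rewrite !big_cons big_nil !addr0 -/(o _) -/(o _) -/(o _) !ot.
by rewrite [RHS]addrC => /addIr.
Qed.

End Values.

(** * Two models *)

(* [twist k] permutes the strands k and k+1 and records the crossing on the
   first of them. *)
Definition twist (k : nat) (v : nat -> int) : nat -> int := fun j =>
  if j == k then v k.+1 + 1 else if j == k.+1 then v k else v j.

Definition untwist (k : nat) (v : nat -> int) : nat -> int := fun j =>
  if j == k then v k.+1 else if j == k.+1 then v k - 1 else v j.

Lemma twistK k : cancel (twist k) (untwist k).
Proof.
move=> v; apply: funext => j; rewrite /twist /untwist.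
by repeat (case: eqP => ? //; subst); lia.
Qed.

Lemma untwistK k : cancel (untwist k) (twist k).
Proof.
move=> v; apply: funext => j; rewrite /twist /untwist.
by repeat (case: eqP => ? //; subst); lia.
Qed.

Lemma twist_braid k v :
  twist k (twist k.+1 (twist k v)) = twist k.+1 (twist k (twist k.+1 v)).
Proof.
apply: funext => j; rewrite /twist.
by repeat (case: eqP => ? //; subst); lia.
Qed.

Lemma twist_comm k l v : (k + 2 <= l)%N ->
  twist k (twist l v) = twist l (twist k v).
Proof.
move=> kl; apply: funext => j; rewrite /twist.
by repeat (case: eqP => ? //; subst); lia.
Qed.

Section Models.
Variables (e r : nat) (A : zmodType) (u : A).
Local Notation X := (braid_gen e r).
Implicit Types (x y : X) (v : nat -> int).

Definition std_pos x : nat :=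
  match x with inl _ => 1%N | inr k => (val k).-1 end.

(* The group of matrices [[1, x, c], [0, M, y], [0, 0, 1]] acts on the columns
   (a, v, 1). Here s_k is the transposition (k-1 k) with y the (k-1)-st basis
   vector, and t_i is the conjugate of the analogous (1 2) by the i-th power of
   the elementary matrix with x the first basis vector, the winding of the first
   strand around the cone point. *)
Definition rot_wt x v : A :=
  match x with inl i => u *~ (i%:Z * (v 2%N - v 1%N + 1)) | inr _ => 0 end.

Local Notation act1 :=
  (word_act rot_wt (fun x => twist (std_pos x)) (fun x => untwist (std_pos x))).

Hypothesis ue : u *+ e = 0.

Lemma mulrz_ordS (i : 'I_e) (z : int) :
  u *~ ((ordS i)%:Z * z) = u *~ (i.+1%:Z * z).
Proof.
rewrite /= [in RHS](divn_eq i.+1 e) PoszD mulrDl mulrzDr PoszM.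
have -> : (i.+1 %/ e)%:Z * e%:Z * z = e%:Z * ((i.+1 %/ e)%:Z * z) by ring.
by rewrite [X in X + _]mulrzA -pmulrn ue mul0rz add0r.
Qed.

(** With w = v 2 - v 1, the weights of t_i and then of t_(i+1) are i (w + 1) and - (i + 1) w. Their
    sum is i - w, where only i depends on the index. *)
Lemma rot_act_tt (i j : 'I_e) p :
  act1 (posword [:: inl (ordS i); inl i]) p =
  shift (u *~ (i%:Z - j%:Z)) (act1 (posword [:: inl (ordS j); inl j]) p).
Proof.
case: p => a v; rewrite /word_act /= /letter_act /shift /= !mulrz_ordS.
congr (_, _); rewrite -!addrA [RHS]addrCA; congr (a + _).
rewrite -!mulrzDr; congr (u *~ _); rewrite /twist /= -!natz; ring.
Qed.

Lemma rot_act_s3t (k : s_index r) (i : 'I_e) : val k = 3 :> nat -> forall p,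
  act1 (posword [:: inr k; inl i; inr k]) p
  = act1 (posword [:: inl i; inr k; inl i]) p.
Proof.
move=> hk [a v]; rewrite /word_act /= /letter_act /= hk /=.
congr (_, _); last exact/esym/twist_braid.
rewrite !addr0 -!addrA -!mulrzDr; congr (a + (u *~ _)); rewrite /twist /=; ring.
Qed.

Lemma rot_act_st (k : s_index r) (i : 'I_e) : (4 <= val k)%N -> forall p,
  act1 (posword [:: inr k; inl i]) p = act1 (posword [:: inl i; inr k]) p.
Proof.
move=> hk [a v]; rewrite /word_act /= /letter_act /= addr0.
have {}hk : (3 < sval k)%N := hk.
congr (_, _); last by rewrite (@twist_comm 1) //; lia.
by rewrite addr0 /twist; case: (nat_of_ord _) hk => [|[|[|[|n]]]].
Qed.

Lemma rot_act_rel s t : @braid_rel e r s t -> exists a, forall p,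
  act1 (posword s) p = shift a (act1 (posword t) p).
Proof.
case=> [i j|k i hk|k i hk|k l hkl|k l hkl].
- by exists (u *~ (i%:Z - j%:Z)) => p; exact: rot_act_tt.
- by exists 0 => p; rewrite shift0 rot_act_s3t.
- by exists 0 => p; rewrite shift0 rot_act_st.
- exists 0 => -[a v]; rewrite shift0 /word_act /= /letter_act /= hkl /=.
  rewrite !addr0; congr (_, _).
  have -> : nat_of_ord (val k) = (val k).-1.+1 by case: k {hkl} => k h /=; lia.
  exact: twist_braid.
- exists 0 => -[a v]; rewrite shift0 /word_act /= /letter_act /=.
  by rewrite !addr0 twist_comm //; case: k l hkl => k hk [l hl] /=; lia.
Qed.

End Models.

(** * The double cover of the symmetric group *)

Section SpinModel.
Variables (A : zmodType) (u : A).
Hypothesis u2 : u *+ 2 = 0.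
Implicit Types v : nat -> int.

(* Modulo 2, v stands for a monomial in Clifford generators x_1, x_2, ..., which
   the map [spin k] below sends to its product by x_k after exchange of x_k and
   x_(k+1); the weight counts the resulting changes of sign. *)
Definition spin_wt (k : nat) v : int := v k * v k.+1 + \sum_(j < k) v j.

Definition spin k (p : A * (nat -> int)) :=
  (p.1 + u *~ spin_wt k p.2, twist k p.2).

Lemma mulrz_mod2 (m n z : int) : m = n + 2 * z -> u *~ m = u *~ n.
Proof.
by move=> ->; rewrite mulrzDr mulrzA -[u *~ 2]/(u *+ 2) u2 mul0rz addr0.
Qed.

Lemma sum_twist_le (k l : nat) v : (k <= l)%N ->
  \sum_(j < k) twist l v j = \sum_(j < k) v j.
Proof.
move=> kl; apply: eq_bigr => j _; have := ltn_ord j => jk.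
by rewrite /twist; case: eqP => [?|_]; first lia; case: eqP => // ?; lia.
Qed.

(** The twist permutes summands and adds one crossing; this 1 is the source of the sign in
    [spin_comm]. *)
Lemma sum_twist_gt (k l : nat) v : (l + 2 <= k)%N ->
  \sum_(j < k) twist l v j = \sum_(j < k) v j + 1.
Proof.
elim: k => [|k IHk] lk; first by lia.
rewrite !big_ord_recr /=; case: (eqVneq k l.+1) => [->|kl].
  rewrite !big_ord_recr /= sum_twist_le // /twist eqxx -[l.+1 == l]/(_ == _).
  rewrite eqxx; case: eqP => [|_]; first lia.
  ring.
rewrite IHk; last lia.
rewrite {1}/twist; case: eqP => [|_]; first lia.
case: eqP => [|_]; first by move/eqP; rewrite (negPf kl).
ring.
Qed.

Lemma spin_comm k l p : (k + 2 <= l)%N ->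
  spin k (spin l p) = shift u (spin l (spin k p)).
Proof.
case: p => a v kl; rewrite /spin /shift /=; congr (_, _);
  last exact: twist_comm.
rewrite -!addrA [RHS]addrCA; congr (a + _).
rewrite -[X in _ = X + _]mulr1z -!mulrzDr.
(* The right-hand side gains 1 from the shift and 1 from the sum over j < l, hence 2 in all. *)
apply: (@mulrz_mod2 _ _ (-1)).
rewrite /spin_wt sum_twist_le ?sum_twist_gt //; last lia.
have -> : twist l v k = v k.
  by rewrite /twist; case: eqP => [|_]; [lia|case: eqP => //; lia].
have -> : twist l v k.+1 = v k.+1.
  by rewrite /twist; case: eqP => [|_]; [lia|case: eqP => //; lia].
have -> : twist k v l = v l.
  by rewrite /twist; case: eqP => [|_]; [lia|case: eqP => //; lia].
have -> : twist k v l.+1 = v l.+1.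
  by rewrite /twist; case: eqP => [|_]; [lia|case: eqP => //; lia].
ring.
Qed.

Lemma spin_commV k l p : (k + 2 <= l)%N ->
  spin l (spin k p) = shift u (spin k (spin l p)).
Proof. by move=> kl; rewrite (@spin_comm k l) // -shiftD -mulr2n u2 shift0. Qed.

Lemma spin_braid k p :
  spin k (spin k.+1 (spin k p)) = spin k.+1 (spin k (spin k.+1 p)).
Proof.
case: p => a v; rewrite /spin /=; congr (_, _); last exact: twist_braid.
rewrite -!addrA -!mulrzDr; congr (a + _).
(* With a, b, c the values of v at k, k+1, k+2, the total weights differ only in 2 b on the left
   against 2 a on the right. *)
apply: (@mulrz_mod2 _ _ (v k.+1 - v k)); rewrite /spin_wt !big_ord_recr /=.
rewrite !sum_twist_le //.
have n1 : (k.+1 == k) = false by lia.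
have n2 : (k.+2 == k) = false by lia.
have n3 : (k.+2 == k.+1) = false by lia.
have n4 : (k == k.+1) = false by lia.
have n5 : (k == k.+2) = false by lia.
have n6 : (k.+1 == k.+2) = false by lia.
rewrite /twist !(eqxx, n1, n2, n3, n4, n5, n6).
ring.
Qed.

Variables (e r : nat) (pos : braid_gen e r -> nat).

Definition spin_wt_at x v : A := u *~ spin_wt (pos x) v.

Lemma spin_word_act s p :
  word_act spin_wt_at (fun x => twist (pos x)) (fun x => untwist (pos x))
    (posword s) p = foldr (fun x => spin (pos x)) p s.
Proof. by elim: s => //= x s ->. Qed.

End SpinModel.

(** * The second homology group *)

Section HomologyIsom.
Variables (G : groupType) (A : zmodType).
Variables (mu : bar_coker G -> A) (psi : A -> bar_coker G).
Hypothesis mu_add : zmod_morphism mu.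
Hypothesis psi_cycle : forall a, coker_d (psi a) = 0.
Hypothesis psiK : cancel psi mu.
Hypothesis psi_onto : forall u, coker_d u = 0 -> exists a, u = psi a.

Let muM : {additive bar_coker G -> A} :=
  HB.pack mu (GRing.isZmodMorphism.Build _ _ mu mu_add).

Definition homology_map (h : group_homology G 2) : A :=
  mu (coker_pi (cycle_val (repr h))).

Lemma homology_mapE (z : cycles G 2) :
  homology_map (\pi z) = mu (coker_pi (cycle_val z)).
Proof.
apply/eqP; rewrite -subr_eq0 -mu_add -raddfB; apply/eqP.
have zz : repr (\pi_(group_homology G 2) z) - z \in @is_boundary G 2.
  by rewrite (Quotient.idealrBE) reprK.
have /asboolP/coker_pi_eq0 h := zz.
rewrite raddfB /= in h; rewrite raddfB.
by apply: (etrans (congr1 mu h)); exact: (raddf0 muM).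
Qed.

Lemma homology_map_add : zmod_morphism homology_map.
Proof.
move=> x y; rewrite -[x]reprK -[y]reprK -raddfB !homology_mapE.
by rewrite -mu_add -raddfB.
Qed.

(** The homology is the kernel of [coker_d], and on this kernel [mu] is inverse to [psi]. *)
Lemma homology_isom : zmod_isom (group_homology G 2) A.
Proof.
pose f : {additive group_homology G 2 -> A} := HB.pack homology_map
  (GRing.isZmodMorphism.Build _ _ homology_map homology_map_add).
exists f.
have cyc a : is_cycle (repr (psi a)).
  by rewrite /is_cycle -coker_dE /coker_pi reprK psi_cycle.
exists (fun a => \pi_(group_homology G 2) (Cycle (cyc a))); last first.
  by move=> a; apply: (etrans (homology_mapE _)); rewrite /coker_pi /= reprK.
move=> h; rewrite -[h in RHS]reprK; apply/eqP.
rewrite -Quotient.idealrBE.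
have /psi_onto[a ha] : coker_d (coker_pi (repr h : bar_chain G 2)) = 0.
  by rewrite coker_dE; apply/eqP; exact: (cycle_valP (repr h)).
apply/asboolP/coker_pi_eq0; rewrite raddfB /= /homology_map ha psiK.
by rewrite {1}/coker_pi reprK subrr.
Qed.

End HomologyIsom.

(** * Cyclic groups as coordinates *)

Section CyclicCoordinates.
Variables (n : nat) (n0 : (0 < n)%N).

(** For n = 1 this is 0. *)
Definition Zgen : Zmod n := inZp 1.

Lemma Zgen_mul (a : Zmod n) : Zgen *+ a = a.
Proof. rewrite Zp_mulrn /Zgen; apply: val_inj => /=.
by rewrite modnMml mul1n modn_small //; exact: ltn_ord.
Qed.

Lemma Zgen_order : Zgen *+ n = 0.
Proof.
rewrite Zp_mulrn /Zgen; apply: val_inj => /=.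
by rewrite modnMml mul1n prednK // modnn.
Qed.

Variables (U : zmodType) (u : U).
Hypothesis un : u *+ n = 0.

Lemma mulrn_mod m : u *+ (m %% n) = u *+ m.
Proof.
by rewrite [in RHS](divn_eq m n) mulrnDr mulnC mulrnA un mul0rn add0r.
Qed.

Lemma Zmod_mulrB (a b : Zmod n) : u *+ (a - b : Zmod n)%R = u *+ a - u *+ b.
Proof.
have D (x y : Zmod n) : u *+ (x + y : Zmod n)%R = u *+ x + u *+ y.
  have modE m : (m %% n.-1.+1 = m %% n)%N by rewrite prednK.
  by rewrite /= modE mulrn_mod mulrnDr.
by apply: (addIr (u *+ b)); rewrite subrK -D subrK.
Qed.

Lemma mulrn_Zgen : u *+ Zgen = u.
Proof. by rewrite -[RHS]mulr1n -[RHS]mulrn_mod /= prednK. Qed.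

End CyclicCoordinates.
Arguments Zgen n : simpl never.

Lemma zmod_closed_image (A U : zmodType) (psi : A -> U) :
  zmod_morphism psi -> zmod_closed [pred u | `[< exists a, u = psi a >]].
Proof.
move=> psiB; split=> [|u v]; rewrite !inE.
  by apply/asboolP; exists 0; rewrite -[X in psi X](subrr 0) psiB subrr.
by move=> /asboolP[a ->] /asboolP[b ->]; apply/asboolP; exists (a - b).
Qed.

(** Chinese remainders: for odd e, the multipliers e + 1 and e are congruent to (1, 0) and (0, 1)
    modulo (e, 2). *)
Lemma Zmod_double e : (0 < e)%N -> odd e ->
  zmod_isom (Zmod e * Zmod 2)%type (Zmod (2 * e)).
Proof.
move=> e0 oe; have e20 : (0 < 2 * e)%N by lia.
pose g := Zgen (2 * e); have gE := Zgen_order e20.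
pose u1 := g *+ e.+1; pose u2 := g *+ e.
have u1e : u1 *+ e = 0.
  have [k ek] : exists k, e.+1 = (2 * k)%N by exists e.+1./2; lia.
  by rewrite /u1 -mulrnA ek mulnAC mulrnA gE mul0rn.
have u2e : u2 *+ 2 = 0 by rewrite /u2 -mulrnA [(e * 2)%N]mulnC gE.
pose f (a : Zmod e * Zmod 2) := u1 *+ a.1 + u2 *+ a.2.
have fB : zmod_morphism f.
  move=> a b; rewrite /f /= (Zmod_mulrB e0 u1e) (Zmod_mulrB _ u2e) //.
  by rewrite opprD addrACA.
pose fM : {additive (Zmod e * Zmod 2)%type -> Zmod (2 * e)} :=
  HB.pack f (GRing.isZmodMorphism.Build _ _ f fB).
exists fM; rewrite /fM /=.
apply: inj_card_bij; last by rewrite card_prod !card_ord; lia.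
have ge2 : Zgen e *+ (2 * e) = 0 by rewrite mulnC mulrnA Zgen_order // mul0rn.
have g22 : Zgen 2 *+ (2 * e) = 0 by rewrite mulrnA Zgen_order // mul0rn.
(* Reduction modulo e and modulo 2 will be a left inverse of [f]. *)
pose h x := (Zgen e *+ nat_of_ord (x : Zmod (2 * e)),
             Zgen 2 *+ nat_of_ord (x : Zmod (2 * e))).
apply: (@can_inj _ _ _ h) => -[a b].
have -> : f (a, b) = g *+ (e.+1 * a + e * b) by rewrite mulrnDr !mulrnA.
have hg m : h (g *+ m) = (Zgen e *+ m, Zgen 2 *+ m).
  have -> : h (g *+ m) = (Zgen e *+ (m %% (2 * e)), Zgen 2 *+ (m %% (2 * e))).
    have -> : (m %% (2 * e))%N = nat_of_ord (g *+ m); last by [].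
    by rewrite Zp_mulrn /= modnMml mul1n prednK.
  by rewrite !mulrn_mod.
rewrite hg; congr (_, _).
  have -> : (e.+1 * a + e * b = a + e * (a + b))%N by nia.
  by rewrite mulrnDr mulrnA Zgen_order // mul0rn addr0 Zgen_mul.
have [k ek] : exists k, (e = 2 * k + 1)%N by exists e./2; lia.
have -> : (e.+1 * a + e * b = b + 2 * (k.+1 * a + k * b))%N by nia.
by rewrite mulrnDr mulrnA Zgen_order // mul0rn addr0 Zgen_mul.
Qed.

(** * Homomorphisms detecting the generating classes *)

Section Detection.
Variables e r : nat.
Hypothesis he : (0 < e)%N.
Hypothesis hr : (3 <= r)%N.
Local Notation G := (presented_group (@braid_rel e r)).
Local Notation i0 := (i0 he).
Local Notation tt_class := (tt_class hr he).
Local Notation st_class := (@st_class e r hr).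

Lemma rot_class : exists2 phi : {additive bar_coker G -> Zmod e},
  phi tt_class = Zgen e & (4 <= r)%N -> forall i, phi (st_class i) = 0.
Proof.
pose K x := twistK (@std_pos e r x); pose K' x := untwistK (@std_pos e r x).
have ue := Zgen_order he.
exists (act_class K K' (rot_act_rel ue) (fun=> 0)).
  (* The index [ordS i0] is 1 only modulo e: for e = 1 it is 0, and so is [Zgen e]. *)
  have hz : Zgen e *~ ((ordS i0)%:Z - i0%:Z) = Zgen e.
    by rewrite subr0 -[X in _ *~ X]mulr1 (mulrz_ordS ue) mulr1.
  rewrite -[RHS]hz; apply: act_class_tt.
    by move=> k i hk p; exact: rot_act_s3t.
  by move=> p; exact: rot_act_tt.
move=> r4 i; apply: (act_class_comm hr); first by apply: gst.
by move=> p; rewrite shift0; apply: rot_act_st; rewrite s_idxE.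
Qed.

Lemma spin_act_rel (A : zmodType) (u : A) : u *+ 2 = 0 -> forall s t,
  @braid_rel e r s t -> exists a, forall p,
    word_act (spin_wt_at u (@std_pos e r)) (fun x => twist (std_pos x))
      (fun x => untwist (std_pos x)) (posword s) p
    = shift a (word_act (spin_wt_at u (@std_pos e r))
      (fun x => twist (std_pos x)) (fun x => untwist (std_pos x))
      (posword t) p).
Proof.
move=> u2 _ _ [i j|k i hk|k i hk|k l hkl|k l hkl].
- by exists 0 => p; rewrite shift0 !spin_word_act.
- exists 0 => p; rewrite shift0 !spin_word_act /= hk; exact/esym/spin_braid.
- exists u => p; rewrite !spin_word_act /=; apply: spin_commV => //.
  by case: k hk => k h /=; lia.
- exists 0 => p; rewrite shift0 !spin_word_act /= hkl /=.
  have -> : nat_of_ord (val k) = (val k).-1.+1 by case: k {hkl} => k h /=; lia.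
  exact: spin_braid.
- exists u => p; rewrite !spin_word_act /=; apply: spin_comm => //.
  by case: k l hkl => k hk [l hl] /=; lia.
Qed.

(** All t_i act alike, on strands 1 and 2, which kills [tt_class]; s_4 acts on strands 3 and 4,
    disjoint from these. *)
Lemma spin_class : (4 <= r)%N -> exists2 phi : {additive bar_coker G -> Zmod 2},
  phi tt_class = 0 & forall i, phi (st_class i) = Zgen 2.
Proof.
move=> r4; have u2 : Zgen 2 *+ 2 = 0 by exact: Zgen_order.
pose K x := twistK (@std_pos e r x); pose K' x := untwistK (@std_pos e r x).
exists (act_class K K' (spin_act_rel u2) (fun=> 0)).
  apply: act_class_tt => [k i hk p|p]; last by rewrite shift0 !spin_word_act.
  by rewrite !spin_word_act /= hk; exact/esym/spin_braid.
move=> i; apply: (act_class_comm hr); first by apply: gst.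
move=> p; rewrite !spin_word_act; apply: spin_commV => //.
by rewrite /std_pos s_idxE.
Qed.

End Detection.

Section FoldedDetection.
Variable e : nat.
Hypothesis he : (0 < e)%N.
Hypothesis e2 : ~~ odd e.
Let hr : (3 <= 4)%N := isT.
Local Notation G := (presented_group (@braid_rel e 4)).
Local Notation i0 := (i0 he).
Local Notation tt_class := (tt_class hr he).
Local Notation st_class := (@st_class e 4 hr).

(* The folding of the D_4 diagram onto A_3 which identifies s_4 with the t_i of
   even index. *)
Definition fold_pos (x : braid_gen e 4) : nat :=
  match x with
  | inl i => if odd i then 3%N else 1%N
  | inr k => if nat_of_ord (val k) == 3%N then 2%N else 1%N
  end.

Lemma odd_ordS (i : 'I_e) : odd (ordS i) = ~~ odd i.
Proof. by rewrite /= odd_mod //=; exact: negbTE. Qed.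

Lemma fold_act_rel (A : zmodType) (u : A) : u *+ 2 = 0 -> forall s t,
  @braid_rel e 4 s t -> exists a, forall p,
    word_act (spin_wt_at u fold_pos) (fun x => twist (fold_pos x))
      (fun x => untwist (fold_pos x)) (posword s) p
    = shift a (word_act (spin_wt_at u fold_pos) (fun x => twist (fold_pos x))
      (fun x => untwist (fold_pos x)) (posword t) p).
Proof.
move=> u2 _ _ [i j|k i hk|k i hk|k l hkl|k l hkl].
(* For indices of opposite parity the two products are those of [spin 1] and [spin 3] in opposite
   orders. *)
- exists (if odd i == odd j then 0 else u) => p; rewrite !spin_word_act /=.
  rewrite -/(nat_of_ord (ordS i)) -/(nat_of_ord (ordS j)) !odd_ordS.
  case: (odd i); case: (odd j) => /=; rewrite ?shift0 //.
    exact: spin_comm.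
  exact: spin_commV.
- exists 0 => p; rewrite shift0 !spin_word_act /= hk /=.
  by case: (odd i); [exact: spin_braid | exact/esym/spin_braid].
- exists (if odd i then u else 0) => p; rewrite !spin_word_act /=.
  rewrite gtn_eqF; last by exact: hk.
  by case: (odd i); rewrite ?shift0 //; exact: spin_comm.
- exists 0 => p; rewrite shift0 !spin_word_act /=.
  have := s_index_bounds k; have := s_index_bounds l.
  rewrite hkl => /andP[_ k4] /andP[k3 _].
  have -> : nat_of_ord (val k) = 3%N by apply/eqP; rewrite eqn_leq -ltnS k4.
  exact/esym/spin_braid.
(* With k at least 3 and l at most 4, the condition k + 2 <= l cannot hold. *)
- have := s_index_bounds k; have := s_index_bounds l => /andP[_ l4] /andP[k3 _].
  by have := leq_trans hkl l4; rewrite leqNgt; lia.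
Qed.

(** This separates the two commutator classes: t_0 acts exactly as s_4 does, while t_1 acts on
    strands disjoint from those of s_4. *)
Lemma fold_class : exists phi : {additive bar_coker G -> Zmod 2},
  [/\ phi tt_class = Zgen 2, phi (st_class i0) = 0 &
      phi (st_class (ordS i0)) = Zgen 2].
Proof.
have u2 : Zgen 2 *+ 2 = 0 by exact: Zgen_order.
have oddE n : odd (n %% e) = odd n by rewrite odd_mod //; exact: negbTE.
have s_num : nat_of_ord (inord (minn (maxn 3 4) 4) : 'I_5) = 4%N.
  by rewrite inordK.
pose K x := twistK (fold_pos x); pose K' x := untwistK (fold_pos x).
exists (act_class K K' (fold_act_rel u2) (fun=> 0)); split.
- apply: act_class_tt => [k i hk p|p]; last first.
    by rewrite !spin_word_act /= !oddE /= !oddE /=; exact: spin_comm.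
  rewrite !spin_word_act /= hk /=.
  by case: (odd i); [exact: spin_braid | exact/esym/spin_braid].
- apply: (act_class_comm hr); first by apply: gst.
  by move=> p; rewrite shift0 !spin_word_act /= s_num.
- apply: (act_class_comm hr); first by apply: gst.
  move=> p; rewrite !spin_word_act /= s_num oddE /=; exact: spin_comm.
Qed.

End FoldedDetection.

(** * Matching the upper and lower bounds *)

Section Computation.
Variables e r : nat.
Hypothesis he : (0 < e)%N.
Hypothesis hr : (3 <= r)%N.
Local Notation G := (presented_group (@braid_rel e r)).
Local Notation i0 := (i0 he).
Local Notation b := (tt_class hr he).
Local Notation c := (@st_class e r hr).

Lemma homology_rank3 : r = 3 -> zmod_isom (group_homology G 2) (Zmod e).
Proof.
move=> r3; have be := tt_class_order hr he.
have [phi phib _] := rot_class he hr.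
pose psi (a : Zmod e) := b *+ a.
have psiB : zmod_morphism psi by move=> x y; exact: Zmod_mulrB.
apply: (homology_isom (mu := phi) (psi := psi)); first exact: raddfB.
- by move=> a; rewrite raddfMn /= tt_class_degree mul0rn.
- by move=> a; rewrite raddfMn /= phib Zgen_mul.
move=> u du; apply/asboolP.
apply: (braid_kernel_sub (zmod_closed_image psiB) (he := he) (hr := hr)) du.
- by apply/asboolP; exists (Zgen e); rewrite /psi mulrn_Zgen.
- by move=> k i; lia.
- by move=> k l; lia.
Qed.

(** The pair ([phi], [chi]) sends [b] and [c i0] to the standard generators, and by
    [braid_kernel_sub] these two classes generate the kernel. *)
Lemma homology_one_commutator_class : (4 <= r)%N ->
    (forall k i, (4 <= k <= r)%N ->
      comm_class (gs e hr k) (@gt e r i) = c i0) ->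
    (forall k l, (3 <= k)%N -> (k + 2 <= l <= r)%N ->
      comm_class (gs e hr k) (gs e hr l) = - c i0) ->
  zmod_isom (group_homology G 2) (Zmod e * Zmod 2)%type.
Proof.
move=> r4 hst hss; have be := tt_class_order hr he.
have c2 := st_class2 hr r4 i0.
have [phi phib phic] := rot_class he hr.
have [chi chib chic] := spin_class he hr r4.
pose psi (a : Zmod e * Zmod 2) := b *+ a.1 + c i0 *+ a.2.
have psiB : zmod_morphism psi.
  by move=> x y; rewrite /psi !Zmod_mulrB // opprD addrACA.
apply: (homology_isom (mu := fun u => (phi u, chi u)) (psi := psi)).
- by move=> x y; rewrite !raddfB.
- move=> a; rewrite raddfD !raddfMn /= tt_class_degree st_class_degree //.
  by rewrite !mul0rn addr0.
- move=> [x y]; rewrite !raddfD !raddfMn /= phib phic // chib chic.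
  by rewrite !mul0rn addr0 add0r !Zgen_mul.
have clH := zmod_closed_image psiB.
have memc : c i0 \in [pred u | `[< exists a, u = psi a >]].
  by apply/asboolP; exists (0, Zgen 2); rewrite /psi add0r (mulrn_Zgen _ c2).
move=> u du; apply/asboolP.
apply: (braid_kernel_sub clH (he := he) (hr := hr)) du.
- by apply/asboolP; exists (Zgen e, 0); rewrite /psi /= mulr0n addr0 mulrn_Zgen.
- by move=> k i hk; rewrite hst.
- by move=> k l hk hl; rewrite hss // -sub0r; apply: clH.2 => //; apply: clH.1.
Qed.

Lemma homology_rank4_odd : r = 4 -> odd e ->
  zmod_isom (group_homology G 2) (Zmod e * Zmod 2)%type.
Proof.
move=> r4 oe; apply: homology_one_commutator_class => [|k i hk|k l];
  [by rewrite r4| |lia].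
have -> : k = 4 by lia.
by apply: st_class_odd; rewrite ?r4.
Qed.

Lemma homology_rank5 : (5 <= r)%N ->
  zmod_isom (group_homology G 2) (Zmod e * Zmod 2)%type.
Proof.
move=> r5; have ci : c i0 = comm_class (gs e hr r) (gs e hr 3).
  by apply: st_class_r => //=; exact: ltnW.
apply: homology_one_commutator_class => [|k i hk|k l hk hl]; first exact: ltnW.
  by rewrite ci; exact: st_class_r.
by rewrite ci; exact: ss_class_r.
Qed.

End Computation.

Lemma homology_rank4_even e : (0 < e)%N -> ~~ odd e ->
  zmod_isom (group_homology (presented_group (@braid_rel e 4)) 2)
    (Zmod e * (Zmod 2 * Zmod 2))%type.
Proof.
move=> he e2; pose hr := isT : (3 <= 4)%N.
pose c := @st_class e 4 hr; pose i := i0 he.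
(* [kap] takes the value [Zgen 2] on both [tt_class] and [d], so it vanishes on their sum [b]; as e
   is even, [b] is still killed by e. *)
pose d := c i + c (ordS i); pose b := tt_class hr he + d.
have c2 j : c j *+ 2 = 0 by exact: st_class2.
have d2 : d *+ 2 = 0 by rewrite mulrnDl !c2 addr0.
have be : b *+ e = 0.
  have [k ek] : exists k, e = (2 * k)%N by exists e./2; lia.
  have dn n : n = (2 * k)%N -> d *+ n = 0.
    by move=> ->; rewrite mulrnA d2 mul0rn.
  by rewrite /b mulrnDl tt_class_order add0r dn.
have cdeg j : coker_d (c j) = 0 by exact: st_class_degree.
have ddeg : coker_d d = 0 by rewrite raddfD /= !cdeg addr0.
have bdeg : coker_d b = 0 by rewrite raddfD /= tt_class_degree ddeg addr0.
have [phi phit phic] := rot_class he hr.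
have [chi chit chic] := spin_class he hr isT.
have [kap [kapt kap0 kap1]] := fold_class he e2.
have g2 : Zgen 2 + Zgen 2 = 0 by rewrite -mulr2n Zgen_order.
have phid : phi d = 0 by rewrite raddfD /= !phic // addr0.
have chid : chi d = 0 by rewrite raddfD /= !chic g2.
have kapd : kap d = Zgen 2 by rewrite raddfD /= kap0 kap1 add0r.
have phib : phi b = Zgen e by rewrite raddfD /= phit phid addr0.
have chib : chi b = 0 by rewrite raddfD /= chit chid addr0.
have kapb : kap b = 0 by rewrite raddfD /= kapt kapd g2.
(* (phi, chi, kap) are the coordinates in the basis (b, c i, d). *)
pose psi (a : Zmod e * (Zmod 2 * Zmod 2)) :=
  b *+ a.1 + (c i *+ a.2.1 + d *+ a.2.2).
have psiB : zmod_morphism psi.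
  move=> x y; rewrite /psi !Zmod_mulrB //.
  by rewrite !opprD [RHS]addrACA; congr (_ + _); exact: addrACA.
apply: (@homology_isom _ (Zmod e * (Zmod 2 * Zmod 2))%type
  (fun u => (phi u, (chi u, kap u))) psi).
- by move=> x y; rewrite !raddfB.
- by move=> a; rewrite 2!raddfD !raddfMn /= bdeg ddeg cdeg !mul0rn !addr0.
- move=> [x [y z]]; rewrite /psi 2!(raddfD phi) 2!(raddfD chi) 2!(raddfD kap).
  rewrite !raddfMn /=.
  rewrite phib phic // phid chib chic chid kapb kap0 kapd.
  by rewrite !mul0rn !(add0r, addr0) !Zgen_mul.
have clH := zmod_closed_image psiB.
set H := (X in zmod_closed X) in clH.
have HN u : u \in H -> - u \in H by move=> uH; rewrite -sub0r clH.2 // clH.1.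
have [_ HB] := clH.
have Hb : b \in H.
  by apply/asboolP; exists (Zgen e, 0);
    rewrite /psi /= !mulr0n !addr0 mulrn_Zgen.
have Hc : c i \in H.
  by apply/asboolP; exists (0, (Zgen 2, 0));
    rewrite /psi add0r addr0 (mulrn_Zgen _ (c2 i)).
have Hd : d \in H.
  by apply/asboolP; exists (0, (0, Zgen 2));
    rewrite /psi !add0r (mulrn_Zgen _ d2).
move=> u du; apply/asboolP.
apply: (braid_kernel_sub clH (he := he) (hr := hr)) du.
- have -> : tt_class hr he = b - d by rewrite addrK.
  exact: HB.
- move=> k j hk; have -> : k = 4 by lia.
  have -> : comm_class (gs e hr 4) (@gt e 4 j) = c j by [].
  (* By parity only the classes of [i] and [ordS i] occur, and the second is [d - c i]. *)
  rewrite /c (st_classE hr isT he j); case: ifP => _ //.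
  have -> : st_class hr (ordS i) = d - c i by rewrite /d addrC addKr.
  exact: HB.
- by move=> k l; lia.
Qed.

Local Close Scope quotient_scope.
Local Close Scope ring_scope.

Theorem theorem1p3 (e r : nat) (he : 1 <= e) (hr : 3 <= r) :
  [/\ r = 3 ->
        zmod_isom (group_homology (braid_group e r) 2) (Zmod e),
      r = 4 -> odd e ->
        zmod_isom (group_homology (braid_group e r) 2) (Zmod e * Zmod 2)%type /\
        zmod_isom (Zmod e * Zmod 2)%type (Zmod (2 * e)),
      r = 4 -> ~~ odd e ->
        zmod_isom (group_homology (braid_group e r) 2)
                  (Zmod e * (Zmod 2 * Zmod 2))%type
    & 5 <= r ->
        zmod_isom (group_homology (braid_group e r) 2) (Zmod e * Zmod 2)%type].
Proof.
split.
- exact: homology_rank3.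
- by move=> r4 oe; split; [exact: homology_rank4_odd | exact: Zmod_double].
- by move=> -> oe; exact: homology_rank4_even.
- exact: homology_rank5.
Qed.
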